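(* Let $n$ be a positive integer and let $D,v>0$. There exists a constant $\epsilon_{n,D}(v)>0$, depending only on $n,D,v$, such that $$\mathrm{ob}(M)>\epsilon_{n,D}(v)$$ for every $M\in\mathcal A(n,D,v)$. More precisely, there exists also a constant $\delta_{n,D}(v)>0$, depending only on $n,D,v$, such that if $M\in\mathcal A(n,D,v)$ and $p,q$ are distinct points of $M$ with $|p,q|<\delta_{n,D}(v)$, then $\mathrm{ob}(p,q)>\epsilon_{n,D}(v)$.
   Context: Alexandrov spaces of curvature $\ge\kappa$ are taken in the sense of Burago–Gromov–Perelman and are assumed finite-dimensional. $|x,y|$ denotes distance. $\mathcal A(n,D,v)$ is the family of $n$-dimensional compact Alexandrov spaces with curvature $\ge -1$, diameter $\le D$ and volume ($n$-dimensional Hausdorff measure) $\ge v$. For a point $p$, $\Sigma_p$ is the space of directions at $p$ with its angle metric $\angle$. For $p\ne q$, $\Uparrow_p^q\subset\Sigma_p$ is the set of all directions at $p$ of minimal geodesics from $p$ to $q$, and $\uparrow_p^q$ denotes an element of $\Uparrow_p^q$. For a set $A\subset \Sigma_p$, $\angle(A,\xi)$ is the distance in $\Sigma_p$ from $\xi$ to $A$. For compact $M$ put $R=\mathrm{rad}(M)=\inf_{p\in M}\sup_{q\in M}|p,q|$. With $B(p,r)$ the open ball, for $p\ne q\in M$ define $$\mathrm{ob}(p;q)=\sup_{x\in B(p,R/2)^c}\angle(\Uparrow_p^q,\uparrow_p^x)-\pi/2$$ (supremum over all $x\in M$ with $|p,x|\ge R/2$ and all $\uparrow_p^x\in\Uparrow_p^x$),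 $\mathrm{ob}(p,q)=\max\{\mathrm{ob}(p;q),\mathrm{ob}(q;p)\}$, and the obtuse constant of $M$ $$\mathrm{ob}(M)=\liminf_{|p,q|\to0}\mathrm{ob}(p,q)\in[0,\pi/2],$$ the liminf being over pairs $p\neq q$ in $M$. *)

(* Defs.v *)
From HB Require Import structures.
From mathcomp Require Import all_boot all_order all_algebra.
From mathcomp Require Import all_classical all_reals all_analysis.
From mathcomp Require Import lra.

Set Implicit Arguments.
Unset Strict Implicit.
Unset Printing Implicit Defensive.

Import Order.TTheory GRing.Theory Num.Theory.
Import numFieldNormedType.Exports.

Local Open Scope classical_set_scope.
Local Open Scope ring_scope.

Section HausdorffMeasure.
Context {R : realType} {M : metricType R}.

(* The maximum with 0 only serves to give the empty set diameter 0. *)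
Definition diam (A : set M) : \bar R :=
  maxe 0%E (ereal_sup [set (mdist x.1 x.2)%:E | x in A `*` A]).

(* Only meant for s > 0: since 0 `^ 0 = 1, for s = 0 the empty members of a
   cover would be counted. *)
Definition hausdorff_content (s e : R) (A : set M) : \bar R :=
  ereal_inf [set (\sum_(0 <= i <oo) poweR (diam (U i)) s)%E
            | U in [set U : nat -> set M |
                A `<=` \bigcup_i U i /\ forall i, (diam (U i) <= e%:E)%E]].

Definition hausdorff_measure (s : R) (A : set M) : \bar R :=
  ereal_sup [set hausdorff_content s e A | e in [set e : R | 0 < e]].

Definition hausdorff_dim (A : set M) : \bar R :=
  ereal_inf [set s%:E | s in [set s : R | 0 < s /\ hausdorff_measure s A = 0%E]].

End HausdorffMeasure.

(* Lebesgue volume of the unit ball of R^n. *)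
Fixpoint ball_volume (R : realType) (n : nat) : R :=
  match n with
  | 0 => 1
  | 1 => 2
  | m.+2 => 2 * pi / m.+2%:R * ball_volume R m
  end.

(* n-dimensional Hausdorff measure, normalized so that it is Lebesgue measure
   in R^n. *)
Definition volume (R : realType) (M : metricType R) (n : nat) : \bar R :=
  ((ball_volume R n / 2 ^+ n)%:E * hausdorff_measure n%:R [set: M])%E.

Section Alexandrov.
Context {R : realType}.

Definition cosh (x : R) : R := (expR x + expR (- x)) / 2.
Definition sinh (x : R) : R := (expR x - expR (- x)) / 2.

(* Angle at [a] of the comparison triangle of (a, b, c) in the hyperbolic plane
   of curvature -1, for a distinct from b and c. *)
Definition hyp_angle (M : metricType R) (a b c : M) : R :=
  acos ((cosh (mdist a b) * cosh (mdist a c) - cosh (mdist b c))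
        / (sinh (mdist a b) * sinh (mdist a c))).

(* Burago-Gromov-Perelman's notion of intrinsic metric; for complete spaces it
   says that distances are infima of lengths of curves. *)
Definition intrinsic_metric (M : metricType R) : Prop :=
  forall (x y : M) (e : R), 0 < e -> exists (N : nat) (z : nat -> M),
    [/\ z 0%N = x, z N = y,
        forall i, (i < N)%N -> mdist (z i) (z i.+1) < e &
        \sum_(i < N) mdist (z i) (z i.+1) < mdist x y + e].

(* The (local) quadruple condition of Burago-Gromov-Perelman. *)
Definition curvature_ge_N1 (M : metricType R) : Prop :=
  forall x : M, exists2 U : set M, nbhs x U &
    forall a b c d : M, U a -> U b -> U c -> U d -> uniq [:: a; b; c; d] ->
      hyp_angle a b c + hyp_angle a c d + hyp_angle a d b <= 2 * pi.

(* The completeness required of an Alexandrov space follows from compactness. *)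
Definition compact_alexandrov_ge_N1 (M : metricType R) : Prop :=
  [/\ compact [set: M], intrinsic_metric M & curvature_ge_N1 M].

Definition alexandrov_family (n : nat) (D v : R) (M : metricType R) : Prop :=
  [/\ compact_alexandrov_ge_N1 M,
      hausdorff_dim [set: M] = (n%:R)%:E,
      (diam [set: M] <= D%:E)%E &
      (v%:E <= volume M n)%E].

End Alexandrov.

Section Directions.
Context {R : realType} {M : metricType R}.

(* [g] restricted to [0, |p,q|] is a minimal geodesic from p to q parametrized
   by arc length; its values outside this interval are irrelevant. *)
Definition min_geodesic (p q : M) (g : R -> M) : Prop :=
  [/\ g 0 = p, g (mdist p q) = q &
      forall s t, 0 <= s <= mdist p q -> 0 <= t <= mdist p q ->
        mdist (g s) (g t) = `|s - t|].

Definition eucl_angle (a b c : M) : R :=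
  acos ((mdist a b ^+ 2 + mdist a c ^+ 2 - mdist b c ^+ 2)
        / (2 * mdist a b * mdist a c)).

(* The limit exists in spaces of curvature bounded below, and it is the same
   for Euclidean and for hyperbolic comparison angles. *)
Definition angle (p : M) (g h : R -> M) : R :=
  lim ((fun st : R * R => eucl_angle p (g st.1) (h st.2))
         @ filter_prod (0 : R)^'+ (0 : R)^'+).

Record geodesic_from (p : M) := GeodesicFrom {
  curve :> R -> M ;
  curveP : exists2 q, p != q & min_geodesic p q curve }.

(* The space of directions at p is the metric completion of the geodesics
   issuing from p for the angle pseudometric.  It is presented here by Cauchy
   sequences, two of which are the same direction when [dangle] is 0. *)
Record direction (p : M) := Direction {
  dseq : nat -> geodesic_from p ;
  dseq_cauchy : forall e : R, 0 < e -> exists N : nat, forall i j : nat,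
    (N <= i)%N -> (N <= j)%N -> angle p (dseq i) (dseq j) < e }.

Definition dangle (p : M) (xi eta : direction p) : R :=
  lim ((fun k => angle p (dseq xi k) (dseq eta k)) @ \oo).

Lemma angle_refl (p : M) (g : geodesic_from p) : angle p g g = 0.
Proof.
case: g => g [q pq [g0 gq gd]] /=.
have l0 : 0 < mdist p q by rewrite mdist_gt0.
apply: norm_cvg_lim; apply: cvg_near_cst.
pose I := [set x : R | 0 < x <= mdist p q].
have I0 : (0 : R)^'+ I.
  near=> x; rewrite /I /=; apply/andP; split; first by [].
  by near: x; exact: nbhs_right_le.
exists (I, I) => // -[s t] [/= /andP[s0 sl] /andP[t0 tl]].
have dp x : 0 < x -> x <= mdist p q -> mdist p (g x) = x.
  move=> x0 xl; rewrite -{1}g0 gd ?lexx ?(ltW l0) ?(ltW x0) //.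
  by rewrite sub0r normrN gtr0_norm.
rewrite /eucl_angle !dp // gd ?(ltW s0) ?(ltW t0) // real_normK ?num_real //.
have -> : s ^+ 2 + t ^+ 2 - (s - t) ^+ 2 = 2 * s * t.
  by rewrite sqrrB mulr2n mulrDl mul1r mulrDl; lra.
by rewrite divff ?acos1 // !mulf_neq0 ?gt_eqF.
Unshelve. all: by end_near.
Qed.

Lemma const_dseq_cauchy (p : M) (g : geodesic_from p) (e : R) : 0 < e ->
  exists N : nat, forall i j : nat, (N <= i)%N -> (N <= j)%N ->
    angle p ((fun=> g) i) ((fun=> g) j) < e.
Proof. by move=> e0; exists 0%N => i j _ _; rewrite angle_refl. Qed.

Definition dir_of (p : M) (g : geodesic_from p) : direction p :=
  Direction (@const_dseq_cauchy p g).

Definition dirs_to (p q : M) : set (direction p) :=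
  [set dir_of g | g in [set g : geodesic_from p | min_geodesic p q g]].

Definition dangle_set (p : M) (A : set (direction p)) (xi : direction p) : R :=
  inf [set dangle xi a | a in A].

End Directions.

Arguments dirs_to {R M} p q _.

Section ObtuseConstant.
Context {R : realType}.

Definition rad (M : metricType R) : R :=
  inf [set sup [set mdist p q | q in [set: M]] | p in [set: M]].

Definition ob_at (M : metricType R) (p q : M) : R :=
  sup [set dangle_set (dirs_to p q) xi
      | xi in \bigcup_(x in [set x : M | rad M / 2 <= mdist p x]) dirs_to p x]
  - pi / 2.

Definition ob_pair (M : metricType R) (p q : M) : R :=
  Num.max (ob_at p q) (ob_at q p).

Definition close_pairs (M : metricType R) : set_system (M * M) :=
  filter_from [set d : R | 0 < d]
    (fun d => [set pq : M * M | pq.1 != pq.2 /\ mdist pq.1 pq.2 < d]).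

Definition ob (M : metricType R) : \bar R :=
  limf_einf (fun pq : M * M => (ob_pair pq.1 pq.2)%:E) (@close_pairs M).

End ObtuseConstant.

(* Main.v *)
Require Import Defs.
From mathcomp Require Import all_boot all_order all_algebra.
From mathcomp Require Import all_classical all_reals all_analysis.
From mathcomp Require Import ring lra.

Set Implicit Arguments.
Unset Strict Implicit.
Unset Printing Implicit Defensive.

Import Order.TTheory GRing.Theory Num.Theory.
Import numFieldNormedType.Exports.

Local Open Scope classical_set_scope.
Local Open Scope ring_scope.

(* Suppose that l = |p,q| is small and ob(p,q) is tiny. The angle bounds at p and
   at q together say that, for every x far from p, the comparison angles at p of
   (p; q, x), hence of (p; q, z) for z on the geodesic [p,x], are almost right.
   Push the set of far points into a ball of radius ~ l around p along geodesics
   from p, and push the result A further along geodesics from q, by N different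
   ratios s in [1/2, 1]. By Toponogov comparison each contraction distorts
   separation only by a bounded factor. The N copies of A are moreover mutually
   separated: otherwise two points z, z' of A would lie (almost) on one geodesic
   from q, and two right-angled triangles (p; q, z), (p; q, z') with that property
   contradict the comparison of [p z'] with the triangle (p, q, z). Hence the ball
   of radius ~ l contains N times as many separated points as A, while A is as
   large as M at the corresponding scale. Comparing with the upper bound
   (const / rho)^n for rho l-separated sets in a ball of radius l bounds N.

   The packing bound itself is a consequence of contraction and of the value of
   the Hausdorff dimension: a configuration that is too rich, copied into smaller
   and smaller balls, yields a Cantor set of dimension > n. The global comparison
   theorem is obtained from the local quadruple condition, in terms of cosines of
   comparison angles, where it becomes linear in cosh of the distance, following
   the proof of the globalization theorem by Alexander, Kapovitch and Petrunin. *)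

(** * Hyperbolic trigonometry *)

Section Hyperbolic.
Context {R : realType}.
Implicit Types x y a b u : R.

Lemma cosh0 : cosh 0 = 1 :> R.
Proof. by rewrite /cosh oppr0 expR0; lra. Qed.

Lemma sinh0 : sinh 0 = 0 :> R.
Proof. by rewrite /sinh oppr0 expR0; lra. Qed.

Lemma coshN x : cosh (- x) = cosh x.
Proof. by rewrite /cosh opprK addrC. Qed.

Lemma sinhN x : sinh (- x) = - sinh x.
Proof. by rewrite /sinh opprK; ring. Qed.

Lemma coshD x y : cosh (x + y) = cosh x * cosh y + sinh x * sinh y.
Proof. by rewrite /cosh /sinh opprD !expRD; field. Qed.

Lemma sinhD x y : sinh (x + y) = sinh x * cosh y + cosh x * sinh y.
Proof. by rewrite /cosh /sinh opprD !expRD; field. Qed.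

Lemma coshB x y : cosh (x - y) = cosh x * cosh y - sinh x * sinh y.
Proof. by rewrite coshD coshN sinhN mulrN. Qed.

Lemma sinhB x y : sinh (x - y) = sinh x * cosh y - cosh x * sinh y.
Proof. by rewrite sinhD coshN sinhN mulrN. Qed.

Lemma cosh_sqr x : cosh x ^+ 2 = 1 + sinh x ^+ 2.
Proof.
by have := coshB x x; rewrite subrr cosh0 => e; rewrite !expr2; lra.
Qed.

Lemma cosh_ge1 x : 1 <= cosh x.
Proof.
have := expRxMexpNx_1 x; have := expR_gt0 x; have := expR_gt0 (- x).
rewrite /cosh; set E := expR x; set E' := expR (- x) => h1 h2 h3.
have : 0 <= (E - E') ^+ 2 by exact: sqr_ge0.
by nra.
Qed.

Lemma cosh_gt0 x : 0 < cosh x.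
Proof. exact: lt_le_trans (cosh_ge1 x). Qed.

Lemma is_derive_sinh x : is_derive x 1 (@sinh R) (cosh x).
Proof.
rewrite /sinh /cosh.
apply: is_derive_eq; rewrite /GRing.scale /=; by field.
Qed.

Lemma sinh_ge u : 0 <= u -> u <= sinh u.
Proof.
move=> u0.
have der x : is_derive x 1 (fun y => sinh y - y) (cosh x - 1).
  have ? := is_derive_sinh x.
  by apply: is_derive_eq.
have := @ger0_derive1_ndecr R (fun y => sinh y - y) 0 u _ _ _ 0 u.
rewrite sinh0 subr0 subr_ge0; apply => //.
- by move=> x _; rewrite derive1E derive_val subr_ge0 cosh_ge1.
- by apply: derivable_within_continuous => x _; apply: ex_derive.
Qed.

Lemma sinh_le u : 0 <= u -> sinh u <= u * expR u.
Proof.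
move=> u0; have := expRxMexpNx_1 u.
have := expR_ge1Dx (- u *+ 2); rewrite mulr2n expRD.
have := expR_gt0 u; have := expR_gt0 (- u).
rewrite /sinh; set E := expR u; set E' := expR (- u) => h1 h2 h3 h4.
have : E * (1 + (- u + -u)) <= E * (E' * E') by rewrite ler_pM2l.
by rewrite mulrA h4; lra.
Qed.

Lemma sinh_ge0 u : 0 <= u -> 0 <= sinh u.
Proof. by move=> u0; exact: le_trans (sinh_ge u0). Qed.

Lemma sinh_gt0 u : 0 < u -> 0 < sinh u.
Proof. by move=> u0; exact: lt_le_trans (sinh_ge (ltW u0)). Qed.

Lemma coshBcosh a b : cosh b - cosh a = 2 * sinh ((a + b) / 2) * sinh ((b - a) / 2).
Proof.
have -> : cosh b = cosh ((a + b) / 2 + (b - a) / 2) by congr cosh; lra.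
have -> : cosh a = cosh ((a + b) / 2 - (b - a) / 2) by congr cosh; lra.
by rewrite coshD coshB; lra.
Qed.

(** With [coshB_le], this trades differences of [cosh] for differences of half squares, up to the
    factor [expR b]. Both rest on the product formula and on [u <= sinh u <= u * expR u]. *)
Lemma coshB_ge a b : 0 <= a -> a <= b -> (b ^+ 2 - a ^+ 2) / 2 <= cosh b - cosh a.
Proof.
move=> a0 ab; rewrite coshBcosh.
have h1 : (a + b) / 2 <= sinh ((a + b) / 2) by apply: sinh_ge; lra.
have h2 : (b - a) / 2 <= sinh ((b - a) / 2) by apply: sinh_ge; lra.
have -> : (b ^+ 2 - a ^+ 2) / 2 = 2 * (((a + b) / 2) * ((b - a) / 2)) by field.
by rewrite -[leRHS]mulrA ler_pM2l// ler_pM //; lra.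
Qed.

Lemma coshB_le a b : 0 <= a -> a <= b ->
  cosh b - cosh a <= expR b * ((b ^+ 2 - a ^+ 2) / 2).
Proof.
move=> a0 ab; rewrite coshBcosh.
have h1 : sinh ((a + b) / 2) <= ((a + b) / 2) * expR ((a + b) / 2).
  by apply: sinh_le; lra.
have h2 : sinh ((b - a) / 2) <= ((b - a) / 2) * expR ((b - a) / 2).
  by apply: sinh_le; lra.
have -> : expR b = expR ((a + b) / 2 + (b - a) / 2) by congr expR; lra.
rewrite expRD -[leLHS]mulrA.
have -> : expR ((a + b) / 2) * expR ((b - a) / 2) * ((b ^+ 2 - a ^+ 2) / 2) =
  2 * (((a + b) / 2 * expR ((a + b) / 2)) * (((b - a) / 2) * expR ((b - a) / 2))).
  by field.
by rewrite ler_pM2l// ler_pM// sinh_ge0//; lra.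
Qed.

Lemma ler_cosh a b : 0 <= a -> 0 <= b -> (cosh a <= cosh b) = (a <= b).
Proof.
have aux x y : 0 <= x -> x <= y -> cosh x <= cosh y.
  move=> x0 xy; rewrite -subr_ge0; apply: le_trans (coshB_ge x0 xy).
  by rewrite divr_ge0// subr_ge0 lerXn2r ?nnegrE//; lra.
move=> a0 b0; apply/idP/idP => [cab|]; last exact: aux.
rewrite leNgt; apply/negP => ba.
have := coshB_ge b0 (ltW ba).
have : 0 < (a - b) * (a + b) by apply: mulr_gt0; lra.
by nra.
Qed.

Lemma ler_sinh a b : a <= b -> sinh a <= sinh b.
Proof.
by move=> ab; rewrite /sinh ler_pM2r ?invr_gt0// lerB// ler_expR// lerN2.
Qed.

Lemma cosh_le_exp u : 0 <= u -> cosh u <= expR u.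
Proof.
by move=> u0; rewrite /cosh; have : expR (- u) <= expR u;
  [rewrite ler_expR|]; lra.
Qed.

Lemma sinh_le_exp u : sinh u <= expR u.
Proof.
by rewrite /sinh; have := expR_gt0 u; have := expR_gt0 (- u); lra.
Qed.

End Hyperbolic.

Local Opaque cosh sinh.

(** * Geodesics *)

Lemma fmap_ultra (S T : Type) (f : S -> T) (F : set_system S) :
  UltraFilter F -> UltraFilter (f @ F).
Proof.
move=> UF; apply: Build_UltraFilter => G PG sFG.
apply/seteqP; split=> A GA; last exact: sFG.
have [//|FA] := in_ultra_setVsetC (f @^-1` A) UF.
have /filter_ex[x [] //] : G (A `&` ~` A) by apply: filterI => //; exact: sFG.
Qed.

Section Geodesics.
Context {R : realType} {M : metricType R}.
Implicit Types (p q x y : M) (g : R -> M).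

Lemma mdist_triB p x y : `|mdist p x - mdist p y| <= mdist x y.
Proof.
have := metric_triangle p x y; have := metric_triangle p y x.
by rewrite (metric_sym y x) ler_norml; lra.
Qed.

(** Parametrize a nearly shortest chain by accumulated length: its total excess is below [e], so no
    piece has a chord shorter than its accumulated length by more than [e]. *)
Lemma approx_geodesic x y (e : R) : intrinsic_metric M -> 0 < e ->
  exists g, [/\ mdist x (g 0) <= e, mdist (g (mdist x y)) y <= 2 * e &
    forall s t, 0 <= s <= mdist x y -> 0 <= t <= mdist x y ->
      `|mdist (g s) (g t) - `|s - t| | <= 3 * e].
Proof.
move=> IM e0; have [N [z [z0 zN zstep zlen]]] := IM x y e e0.
pose T i := \sum_(j < i) mdist (z j) (z j.+1).
have TS i : T i.+1 = T i + mdist (z i) (z i.+1) by rewrite /T big_ord_recr.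
have T0 : T 0%N = 0 by rewrite /T big_ord0.
have dT i k : mdist (z i) (z (i + k)%N) <= T (i + k)%N - T i.
  elim: k => [|k IH]; first by rewrite addn0 mdistxx subrr.
  rewrite addnS TS; have := metric_triangle (z i) (z (i + k)%N) (z (i + k).+1).
  by lra.
have dTle i j : (i <= j)%N -> mdist (z i) (z j) <= T j - T i.
  by move=> ij; rewrite -(subnKC ij); exact: dT.
have Tle i j : (i <= j)%N -> T i <= T j.
  by move=> /dTle; have := mdist_ge0 (z i) (z j); lra.
(* The range condition is put under the existential so that [choice] yields a total index
   function. *)
have idx (s : R) : exists i, 0 <= s <= mdist x y -> [/\ (i <= N)%N, T i <= s & s <= T i + e].
  case: (boolP (0 <= s <= mdist x y)) => [/andP[s0 sL]|_]; last by exists 0%N.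
  have sT : s <= T N.
    by have := dTle 0%N N isT; rewrite z0 zN T0 subr0; apply: le_trans.
  suff : forall m, (m <= N)%N -> s <= T m -> exists i, [/\ (i <= N)%N, T i <= s & s <= T i + e].
    by move=> /(_ N (leqnn _) sT) [i Hi]; exists i.
  elim=> [|m IH] mN; first by rewrite T0 => ?; exists 0%N; rewrite T0; split => //; lra.
  case: (leP s (T m)) => [sm _|sm]; first exact: IH (ltnW mN) sm.
  rewrite TS => sm'; exists m; split; [exact: ltnW|lra|].
  by have := zstep _ mN; lra.
have [i iP] := choice idx.
have L0 : 0 <= mdist x y by exact: mdist_ge0.
have TN : T N < mdist x y + e by exact: zlen.
have dij (s t : R) : 0 <= s -> s <= t -> t <= mdist x y ->
    `|mdist (z (i s)) (z (i t)) - (t - s)| <= 3 * e.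
  move=> s0 st tL.
  have [iN Ti1 Ti2] : [/\ (i s <= N)%N, T (i s) <= s & s <= T (i s) + e].
    by apply: iP; lra.
  have [jN Tj1 Tj2] : [/\ (i t <= N)%N, T (i t) <= t & t <= T (i t) + e].
    by apply: iP; lra.
  have up : mdist (z (i s)) (z (i t)) <= (t - s) + e.
    case: (leqP (i s) (i t)) => ij; first by have := dTle _ _ ij; lra.
    by have := dTle _ _ (ltnW ij); have := Tle _ _ (ltnW ij); rewrite metric_sym; lra.
  have lo : (t - s) - 3 * e <= mdist (z (i s)) (z (i t)).
    have := metric_triangle x (z (i s)) y; have := metric_triangle (z (i s)) (z (i t)) y.
    have := dTle _ _ (leq0n (i s)); have := dTle _ _ jN; rewrite z0 zN T0; lra.
  by rewrite ler_norml; lra.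
exists (fun s => z (i s)); split.
- have [_ Ti1 Ti2] : [/\ (i 0%R <= N)%N, T (i 0%R) <= 0 & 0 <= T (i 0%R) + e] by apply: iP; lra.
  by have := dTle _ _ (leq0n (i 0%R)); rewrite z0 T0; lra.
- set L := mdist x y in TN L0 dij iP *.
  have [iN Ti1 Ti2] : [/\ (i L <= N)%N, T (i L) <= L & L <= T (i L) + e].
    by apply: iP; rewrite L0 lexx.
  by have := dTle _ _ iN; rewrite zN; lra.
- move=> s t /andP[s0 sL] /andP[t0 tL]; case: (leP s t) => st.
    by rewrite (distrC s t) (@ger0_norm _ (t - s)) ?subr_ge0//; exact: dij.
  by rewrite (@gtr0_norm _ (s - t)) ?subr_gt0// metric_sym; apply: dij => //; exact: ltW.
Qed.

(* A limit of approximate geodesics along an ultrafilter. *)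
Lemma geodesic_exists x y : compact [set: M] -> intrinsic_metric M ->
  exists g, min_geodesic x y g.
Proof.
move=> cM IM; set L := mdist x y.
have /choice[G GP] : forall e : R, exists g, 0 < e ->
    [/\ mdist x (g 0) <= e, mdist (g L) y <= 2 * e &
    forall s t, 0 <= s <= L -> 0 <= t <= L ->
      `|mdist (g s) (g t) - `|s - t| | <= 3 * e].
  move=> e; case: (ltP 0 e) => e0; last by exists (fun=> x).
  by have [g gP] := approx_geodesic x y IM e0; exists g.
have [U [UU sU]] := ultraFilterLemma (at_right_proper_filter (0 : R)).
have /choice[g gP] : forall s, exists z : M, (fun e => G e s) @ U --> z.
  move=> s; move: cM; rewrite compact_ultra => /(_ _ (fmap_ultra (fun e => G e s) UU)).
  by case=> [|z [_ ?]]; [exact: filterT | exists z].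
have PU := ultra_proper (F := U).
have pick (e : R) (s t : R) : 0 < e -> exists h, [/\ 0 < h < e, mdist (g s) (G h s) < e & mdist (g t) (G h t) < e].
  move=> e0; apply: (@filter_ex _ U).
  have U1 : U [set h | 0 < h < e].
    apply: sU; near=> h => /=; apply/andP; split; first by [].
    by near: h; exact: nbhs_right_lt.
  have U2 r : U [set h | mdist (g r) (G h r) < e].
    exact: (metricType_numDomainType.cvgr_dist_lt (gP r) e0).
  by apply: filterS (filterI U1 (filterI (U2 s) (U2 t))) => h /= [? []].
exists g; split.
- apply: contrapT => /eqP ne; have d0 : 0 < mdist (g 0) x by rewrite mdist_gt0.
  have [h [/andP[h0 he] hs _]] : exists h : R, [/\ 0 < h < mdist (g 0) x / 3, mdist (g 0) (G h 0) < mdist (g 0) x / 3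
    & mdist (g 0) (G h 0) < mdist (g 0) x / 3] by apply: pick; lra.
  have [xg _ _] := GP h h0.
  have := metric_triangle (g 0) (G h 0) x; rewrite (metric_sym (G h 0) x); lra.
- apply: contrapT => /eqP ne; have d0 : 0 < mdist (g L) y by rewrite mdist_gt0.
  have [h [/andP[h0 he] hs _]] : exists h : R, [/\ 0 < h < mdist (g L) y / 3, mdist (g L) (G h L) < mdist (g L) y / 3
    & mdist (g L) (G h L) < mdist (g L) y / 3] by apply: pick; lra.
  have [_ xg _] := GP h h0.
  have := metric_triangle (g L) (G h L) y; lra.
- move=> s t sL tL; apply/eqP; rewrite -subr_eq0 -normr_eq0; apply/eqP/le_anti; rewrite normr_ge0 andbT.
  apply/ler_addgt0Pl => e e0; rewrite addr0.
  have [h [/andP[h0 he] hs ht]] : exists h : R, [/\ 0 < h < e / 5, mdist (g s) (G h s) < e / 5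
    & mdist (g t) (G h t) < e / 5] by apply: pick; lra.
  have [_ _ /(_ s t sL tL)] := GP h h0.
  have := mdist_triB (g s) (G h t) (g t); rewrite (metric_sym (G h t)).
  have := mdist_triB (G h t) (g s) (G h s); rewrite !(metric_sym (G h t)).
  move: (`|s - t|) => u.
  rewrite !ler_norml; lra.
Unshelve. all: by end_near.
Qed.

End Geodesics.

(** * Comparison cosines and the Stewart inequality *)

(** Cosine, by the hyperbolic law of cosines, of the angle opposite to the side [d]. It is affine in
    [cosh d], which keeps the comparison inequalities linear. *)
Definition hyp_cos {R : realType} (a b d : R) : R :=
  (cosh a * cosh b - cosh d) / (sinh a * sinh b).

Section HypCos.
Context {R : realType}.
Implicit Types a b d e f : R.

Lemma hyp_cosC a b d : hyp_cos a b d = hyp_cos b a d.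
Proof. by rewrite /hyp_cos (mulrC (cosh b)) (mulrC (sinh b)). Qed.

Lemma hyp_cos_itv a b d : 0 < a -> 0 < b -> `|a - b| <= d -> d <= a + b ->
  -1 <= hyp_cos a b d <= 1.
Proof.
move=> a0 b0 d1 d2; have d0 : 0 <= d by exact: le_trans d1.
have ab0 : 0 < sinh a * sinh b by rewrite mulr_gt0// sinh_gt0.
rewrite /hyp_cos ler_pdivlMr// ler_pdivrMr//.
have h1 : cosh d <= cosh (a + b) by rewrite ler_cosh//; lra.
have h2 : cosh (a - b) <= cosh d.
  case: (leP b a) => ab.
    by rewrite ler_cosh ?subr_ge0//; move: d1; rewrite ger0_norm ?subr_ge0.
  rewrite -opprB coshN ler_cosh ?subr_ge0//; last exact: ltW.
  by move: d1; rewrite distrC gtr0_norm ?subr_gt0.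
by rewrite coshD in h1; rewrite coshB in h2; lra.
Qed.

Lemma hyp_cos_side a b d : 0 < a -> 0 < b ->
  cosh d = cosh a * cosh b - sinh a * sinh b * hyp_cos a b d.
Proof.
move=> /sinh_gt0 a0 /sinh_gt0 b0; rewrite /hyp_cos; field.
by rewrite !gt_eqF.
Qed.

Lemma hyp_cos_ge a b d k : 0 < a -> 0 < b ->
  (k <= hyp_cos a b d) = (cosh d <= cosh a * cosh b - sinh a * sinh b * k).
Proof.
move=> a0 b0; have ab0 := mulr_gt0 (sinh_gt0 a0) (sinh_gt0 b0).
rewrite /hyp_cos ler_pdivlMr//.
by apply/idP/idP => H; lra.
Qed.

Lemma hyp_cos_le a b d k : 0 < a -> 0 < b ->
  (hyp_cos a b d <= k) = (cosh a * cosh b - sinh a * sinh b * k <= cosh d).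
Proof.
move=> a0 b0; have ab0 := mulr_gt0 (sinh_gt0 a0) (sinh_gt0 b0).
rewrite /hyp_cos ler_pdivrMr//.
by apply/idP/idP => H; lra.
Qed.

(* In both lemmas [a], [b] are the lengths of two consecutive pieces of a
   geodesic, and [e], [d], [f] the distances from a point to its three nodes;
   the Stewart inequality says that [cosh] of the distance satisfies
   [y'' <= y] in the barrier sense. *)
Lemma stewart_of_angles a b d e f : 0 < a -> 0 < b -> 0 < d ->
  0 <= hyp_cos a d e + hyp_cos b d f ->
  sinh b * cosh e + sinh a * cosh f <= sinh (a + b) * cosh d.
Proof.
move=> a0 b0 d0.
have := hyp_cos_side e a0 d0; have := hyp_cos_side f b0 d0.
move: (hyp_cos a d e) (hyp_cos b d f) => k1 k2 -> -> kk.
have sab : 0 <= sinh a * sinh b * sinh d.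
  by apply: ltW; apply: mulr_gt0; [apply: mulr_gt0|]; exact: sinh_gt0.
have := mulr_ge0 sab kk.
by rewrite sinhD; lra.
Qed.

Lemma stewart_monotone a b d e f : 0 < a -> 0 <= b -> 0 < e ->
  sinh b * cosh e + sinh a * cosh f <= sinh (a + b) * cosh d ->
  hyp_cos e a d <= hyp_cos e (a + b) f.
Proof.
move=> a0 b0 e0 st; have ab0 : 0 < a + b by lra.
have ea0 := mulr_gt0 (sinh_gt0 e0) (sinh_gt0 a0).
have eab0 := mulr_gt0 (sinh_gt0 e0) (sinh_gt0 ab0).
rewrite /hyp_cos ler_pdivrMr// [leRHS]mulrAC ler_pdivlMr//.
have sa := sinh_gt0 a0; have se := sinh_gt0 e0.
have := ler_wpM2l (ltW se) st.
have -> : sinh b = sinh (a + b) * cosh a - cosh (a + b) * sinh a.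
  by rewrite -sinhB; congr sinh; lra.
by lra.
Qed.

(** Turns a bound on a sum of angles into a linear one on cosines: [acos a] is at most
    [pi - acos b], that is [acos (- b)], and [cos] decreases. *)
Lemma acosD_lepi a b : -1 <= a <= 1 -> -1 <= b <= 1 -> acos a + acos b <= pi ->
  0 <= a + b.
Proof.
move=> a1 b1 ab.
have b1' : -1 <= - b <= 1 by lra.
rewrite -[a]acosK ?in_itv//= -[b]opprK -[- b]acosK ?in_itv//= subr_ge0.
have [a0 a2] := (acos_ge0 a1, acos_lepi a1).
have [c0 c2] := (acos_ge0 b1', acos_lepi b1').
have : acos a <= acos (- b) by rewrite acosN//; lra.
rewrite le_eqVlt => /predU1P[->//|lt].
by apply: ltW; rewrite ltr_cos ?in_itv/= ?a0 ?c0.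
Qed.

End HypCos.

(** * Point-on-side comparison from the quadruple condition *)

Section Comparison.
Context {R : realType} {M : metricType R}.
Implicit Types (p q x y z : M) (g h : R -> M).

(** Toponogov's point-on-side comparison: [z] is at least as far from [p] as the corresponding point
    in the comparison triangle of [p], [x], [y]. The premise places [z] between [x] and [y] without
    choosing a geodesic. *)
Definition stewart x y z p : Prop :=
  mdist x z + mdist z y = mdist x y ->
  sinh (mdist z y) * cosh (mdist p x) + sinh (mdist x z) * cosh (mdist p y)
  <= sinh (mdist x y) * cosh (mdist p z).

Lemma hyp_cos_mdist p x y : p != x -> p != y ->
  -1 <= hyp_cos (mdist p x) (mdist p y) (mdist x y) <= 1.
Proof.
move=> px py; apply: hyp_cos_itv; rewrite ?mdist_gt0 ?mdist_triB//.
by rewrite (metric_sym p x) metric_triangle.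
Qed.

Lemma stewart_refl x y p : stewart x y x p /\ stewart x y y p.
Proof.
by split=> _; rewrite mdistxx sinh0 mul0r ?addr0 ?add0r.
Qed.

(** Since [z] lies between [x] and [y], the comparison angle there is [pi], so the quadruple
    condition leaves at most [pi] for the other two. The cases of coinciding points, excluded by
    [uniq], are checked by hand. *)
Lemma quadruple_stewart x y z p :
  (uniq [:: z; x; y; p] ->
   hyp_angle z x y + hyp_angle z y p + hyp_angle z p x <= 2 * pi) ->
  stewart x y z p.
Proof.
move=> quad.
have [->|xz] := eqVneq x z; first by have [] := stewart_refl z y p.
have [->|yz] := eqVneq y z; first by have [] := stewart_refl x z p.
move=> xzy.
have a0 : 0 < mdist x z by rewrite mdist_gt0.
have b0 : 0 < mdist z y by rewrite mdist_gt0 eq_sym.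
have [->|pz] := eqVneq p z.
  by rewrite -xzy mdistxx (metric_sym z x) sinhD cosh0; lra.
have [->|px] := eqVneq p x.
  rewrite mdistxx cosh0 -xzy coshD sinhD.
  have : sinh (mdist z y) * (cosh (mdist x z) * cosh (mdist x z)) =
    sinh (mdist z y) * (1 + sinh (mdist x z) * sinh (mdist x z)).
    by rewrite -!expr2 cosh_sqr.
  by lra.
have [->|py] := eqVneq p y.
  rewrite mdistxx (metric_sym y x) -xzy (metric_sym y z) cosh0 coshD sinhD.
  have : sinh (mdist x z) * (cosh (mdist z y) * cosh (mdist z y)) =
    sinh (mdist x z) * (1 + sinh (mdist z y) * sinh (mdist z y)).
    by rewrite -!expr2 cosh_sqr.
  by lra.
have xy : x != y.
  by apply/eqP => e; move: a0 xzy; rewrite e mdistxx; lra.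
have : hyp_angle z x y + hyp_angle z y p + hyp_angle z p x <= 2 * pi.
  by apply: quad; rewrite /= !inE !negb_or (eq_sym z x) xz (eq_sym z y) yz (eq_sym z p)
    pz xy (eq_sym x p) px (eq_sym y p) py.
have zx : z != x by rewrite eq_sym.
have zy : z != y by rewrite eq_sym.
have zp : z != p by rewrite eq_sym.
rewrite /hyp_angle.
have -> : (cosh (mdist z x) * cosh (mdist z y) - cosh (mdist x y)) /
   (sinh (mdist z x) * sinh (mdist z y)) = -1.
  rewrite -xzy (metric_sym z x) coshD; field.
  by rewrite !gt_eqF ?sinh_gt0.
rewrite acosN1 => H.
have H1 := hyp_cos_mdist zy zp; have H2 := hyp_cos_mdist zp zx.
have := acosD_lepi H1 H2; rewrite /hyp_cos => /(_ _)/wrap[]; first by lra.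
have d0 : 0 < mdist z p by rewrite mdist_gt0.
rewrite -!/(hyp_cos _ _ _) (hyp_cosC (mdist z p)) (metric_sym z x) addrC => H3.
by have := stewart_of_angles a0 b0 d0 H3; rewrite xzy (metric_sym y p) (metric_sym z p).
Qed.

(** A Lebesgue number argument: compactness turns the neighbourhoods of the local condition into
    balls of one common radius. *)
Lemma uniform_stewart : compact [set: M] -> curvature_ge_N1 M ->
  exists2 r : R, 0 < r & forall c x y z p, mdist c x < r -> mdist c y < r ->
    mdist c z < r -> mdist c p < r -> stewart x y z p.
Proof.
move=> /compact_near_coveringP cM curv.
pose P r c := forall x y z p, mdist c x < r -> mdist c y < r ->
    mdist c z < r -> mdist c p < r -> stewart x y z p.
have : forall c, [set: M] c -> \forall c' \near c & r \near (0 : R)^'+, P r c'.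
  move=> c _; have [U cU UP] := curv c.
  have [e e0 eU] : exists2 e : R, 0 < e & forall y, mdist c y < e -> U y.
    move: cU; rewrite -metricType_numDomainType.filter_from_mdist_nbhs => -[e e0 eU].
    by exists e.
  exists ([set y | mdist c y < e / 2], [set r | r < e / 2]).
    split => /=; last by apply: nbhs_right_lt; lra.
    rewrite -metricType_numDomainType.filter_from_mdist_nbhs; exists (e / 2) => //=; lra.
  move=> [c' r] /= [cc' re] x y z p xr yr zr pr.
  apply: quadruple_stewart; apply: UP; apply: eU.
  - by apply: le_lt_trans (metric_triangle _ c' _) _; lra.
  - by apply: le_lt_trans (metric_triangle _ c' _) _; lra.
  - by apply: le_lt_trans (metric_triangle _ c' _) _; lra.
  - by apply: le_lt_trans (metric_triangle _ c' _) _; lra.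
move=> /cM H; have [r [r0 rH]] : exists r : R, 0 < r /\ [set: M] `<=` P r.
  apply: (@filter_ex _ (0%R)^'+); apply: filterI => //.
  exact: nbhs_right_gt.
by exists r => // c; exact: rH.
Qed.

End Comparison.

(** * Angles of hinges *)

Local Notation corner R := (filter_prod (0 : R)^'+ (0 : R)^'+).

Section Corner.
Context {R : realType}.
Implicit Types f : R * R -> R.

Lemma near_corner (e : R) : 0 < e ->
  \forall st \near corner R, [/\ 0 < st.1, st.1 < e, 0 < st.2 & st.2 < e].
Proof.
move=> e0; have N : (0 : R)^'+ [set s | 0 < s < e].
  near=> s => /=; apply/andP; split; first by [].
  by near: s; exact: nbhs_right_lt.
exists ([set s | 0 < s < e], [set s | 0 < s < e]) => //.
by move=> [s t] /= [/andP[? ?] /andP[? ?]].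
Unshelve. all: by end_near. Qed.

(** The limit is the infimum: it is nearly attained at one pair of parameters, and monotonicity
    carries this to all smaller pairs. *)
Lemma monotone_cvg_corner f (a b B : R) : 0 < a -> 0 < b ->
  (forall s t, 0 < s <= a -> 0 < t <= b -> B <= f (s, t)) ->
  (forall s s' t t', 0 < s -> s <= s' -> s' <= a -> 0 < t -> t <= t' -> t' <= b ->
    f (s, t) <= f (s', t')) ->
  exists C, f @ corner R --> C /\
    forall s t, 0 < s <= a -> 0 < t <= b -> C <= f (s, t).
Proof.
move=> a0 b0 fB fmono.
pose S := [set f st | st in [set st | 0 < st.1 <= a /\ 0 < st.2 <= b]].
have S0 : S !=set0 by exists (f (a, b)), (a, b) => //=; rewrite a0 b0 !lexx.
have SB : has_lbound S by exists B => _ [[s t] /= [? ?] <-]; exact: fB.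
have Cle s t : 0 < s <= a -> 0 < t <= b -> inf S <= f (s, t).
  by move=> sr tr; apply: ge_inf => //; exists (s, t).
exists (inf S); split => //.
apply/cvgrPdist_lt => e e0.
have [_ [[s t] /= [sr tr] <-] fst] := inf_adherent e0 (conj S0 SB).
have [sr' tr'] : s <= a /\ t <= b by move: sr tr => /andP[_ ?] /andP[_ ?].
near=> st.
have [s0 sm t0 tm] : [/\ 0 < st.1, st.1 < Num.min s t, 0 < st.2 & st.2 < Num.min s t].
  by near: st; apply: near_corner; rewrite lt_min; lra.
move: sm tm; rewrite !lt_min => /andP[ss st'] /andP[ts tt].
have h1 : inf S <= f (st.1, st.2).
  by apply: Cle; rewrite ?s0 ?t0 /= ltW// ?(lt_le_trans ss) ?(lt_le_trans tt).
have h2 : f (st.1, st.2) <= f (s, t) by apply: fmono => //; exact: ltW.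
rewrite -surjective_pairing in h1 h2.
by rewrite ltr_norml; lra.
Unshelve. all: by end_near. Qed.

Lemma cvg_corner_swap f (C : R) :
  f @ corner R --> C -> (fun st => f (st.2, st.1)) @ corner R --> C.
Proof.
move=> fC A /fC [[P Q] [P0 Q0] PQ]; exists (Q, P) => //.
by move=> [s t] [/= ? ?]; exact: PQ.
Qed.

End Corner.

Section Subgeodesics.
Context {R : realType} {M : metricType R}.
Implicit Types (p q x y z : M) (g h : R -> M).

Lemma geo_dist p q g s : min_geodesic p q g -> 0 <= s <= mdist p q -> mdist p (g s) = s.
Proof.
move=> [g0 _ gd] /andP[s0 sL]; rewrite -g0 gd ?lexx ?mdist_ge0//; last by rewrite s0.
by rewrite sub0r normrN ger0_norm.
Qed.

Lemma geo_dist_end p q g s : min_geodesic p q g -> 0 <= s <= mdist p q ->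
  mdist (g s) q = mdist p q - s.
Proof.
move=> [_ g1 gd] /andP[s0 sL]; rewrite -{1}g1 gd ?lexx ?mdist_ge0//; last by rewrite s0.
by rewrite distrC ger0_norm// subr_ge0.
Qed.

Lemma geo_head p q g u : min_geodesic p q g -> 0 <= u <= mdist p q ->
  min_geodesic p (g u) g.
Proof.
move=> gg uL; have du := geo_dist gg uL; case: gg => g0 g1 gd.
by split; rewrite ?du// => s t sL tL; apply: gd; lra.
Qed.

Lemma geo_tail p q g u : min_geodesic p q g -> 0 <= u <= mdist p q ->
  min_geodesic (g u) q (fun s => g (u + s)).
Proof.
move=> gg uL; have du := geo_dist_end gg uL; case: gg => g0 g1 gd.
split; rewrite ?addr0 ?du//; first by rewrite addrC subrK.
move=> s t sL tL; rewrite gd; [|lra|lra].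
by congr (`|_|); lra.
Qed.

Lemma geo_back p q g u : min_geodesic p q g -> 0 <= u <= mdist p q ->
  min_geodesic (g u) p (fun s => g (u - s)).
Proof.
move=> gg uL; have du := geo_dist gg uL; case: gg => g0 g1 gd.
split; rewrite ?subr0 // ?(metric_sym (g u)) ?du ?subrr//.
move=> s t sL tL; rewrite gd; [|lra|lra].
by rewrite distrC; congr (`|_|); lra.
Qed.

End Subgeodesics.

Section Hinges.
Context {R : realType} {M : metricType R}.
Implicit Types (p q x y z : M) (g h : R -> M).

Definition hcos g h (st : R * R) : R := hyp_cos st.1 st.2 (mdist (g st.1) (h st.2)).

Definition cosang g h : R := lim (hcos g h @ corner R).

(** Toponogov's hinge comparison: the right-hand side is [cosh] of the third side of the hyperbolic
    hinge with the same sides and angle. *)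
Definition hinge (x p q : M) g h : Prop :=
  cosh (mdist p q) <= cosh (mdist x p) * cosh (mdist x q) -
    sinh (mdist x p) * sinh (mdist x q) * cosang g h.

(** Comparison angles shrink as the sides grow. Lengthening one side is the Stewart inequality for a
    point inside that side, seen from the end of the other side; the two sides are lengthened in
    turn. *)
Lemma hcos_monotone x p q g h a b r : min_geodesic x p g -> min_geodesic x q h ->
  a <= mdist x p -> b <= mdist x q -> a <= r -> b <= r ->
  (forall x' y' z' p', mdist x x' <= r -> mdist x y' <= r ->
    mdist x z' <= r -> mdist x p' <= r -> stewart x' y' z' p') ->
  forall s s' t t', 0 < s -> s <= s' -> s' <= a -> 0 < t -> t <= t' -> t' <= b ->
    hcos g h (s, t) <= hcos g h (s', t').
Proof.
move=> + + ap bq ar br loc.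
have main (p' q' : M) (g' h' : R -> M) s t t' :
    min_geodesic x p' g' -> min_geodesic x q' h' ->
    s <= mdist x p' -> t' <= mdist x q' -> 0 < s -> s <= r ->
    0 < t -> t <= t' -> t' <= r -> hcos g' h' (s, t) <= hcos g' h' (s, t').
  move=> g'g h'h sp tq s0 sr t0 tt' t'r.
  have [-> //|ne] := eqVneq t t'.
  have d0 : 0 < t' - t by rewrite subr_gt0 lt_neqAle ne.
  have xt : mdist x (h' t) = t by apply: (geo_dist h'h); lra.
  have xt' : mdist x (h' t') = t' by apply: (geo_dist h'h); lra.
  have xs : mdist x (g' s) = s by apply: (geo_dist g'g); lra.
  have tt : mdist (h' t) (h' t') = t' - t.
    by case: h'h => _ _ ->; rewrite ?ltr0_norm; lra.
  have e : t + (t' - t) = t' by rewrite addrC subrK.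
  have st : sinh (t' - t) * cosh s + sinh t * cosh (mdist (g' s) (h' t')) <=
      sinh t' * cosh (mdist (g' s) (h' t)).
    have := @loc x (h' t') (h' t) (g' s).
    rewrite mdistxx xt xt' xs /stewart tt xt xt' (metric_sym _ x) xs.
    by clear -sr s0 t0 tt' t'r e; apply; lra.
  rewrite /hcos /= -[X in _ <= hyp_cos _ X _]e.
  by apply: stewart_monotone; [|exact: ltW| |rewrite e].
move=> gg hh s s' t t' s0 ss' s'a t0 tt' t'b.
have s'0 : 0 < s' by exact: lt_le_trans ss'.
have t'0 : 0 < t' by exact: lt_le_trans tt'.
have sa : s <= a by exact: le_trans s'a.
apply: (@le_trans _ _ (hcos g h (s, t'))).
  by apply: (main p q) => //; [exact: le_trans ap|exact: le_trans bq
    |exact: le_trans ar|exact: le_trans br].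
have C u v : hcos g h (u, v) = hcos h g (v, u) by rewrite /hcos hyp_cosC metric_sym.
by rewrite !C; apply: (main q p) => //; [exact: le_trans bq|exact: le_trans ap
  |exact: le_trans br|exact: le_trans ar].
Qed.

Lemma hcos_itv x p q g h s t : min_geodesic x p g -> min_geodesic x q h ->
  0 < s <= mdist x p -> 0 < t <= mdist x q -> -1 <= hcos g h (s, t) <= 1.
Proof.
move=> gg hh sp tq.
have xs : mdist x (g s) = s by apply: (geo_dist gg); lra.
have xt : mdist x (h t) = t by apply: (geo_dist hh); lra.
rewrite /hcos /= -[X in hyp_cos X _]xs -[X in hyp_cos _ X]xt.
by apply: hyp_cos_mdist; rewrite -mdist_gt0 ?xs ?xt; lra.
Qed.

End Hinges.

Section Cosang.
Context {R : realType} {M : metricType R}.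
Implicit Types (p q x y z : M) (g h : R -> M).

Lemma cosang_spec x p q g h a b r : min_geodesic x p g -> min_geodesic x q h ->
  0 < a -> 0 < b -> a <= mdist x p -> b <= mdist x q -> a <= r -> b <= r ->
  (forall x' y' z' p', mdist x x' <= r -> mdist x y' <= r ->
    mdist x z' <= r -> mdist x p' <= r -> stewart x' y' z' p') ->
  hcos g h @ corner R --> cosang g h /\
  forall s t, 0 < s <= a -> 0 < t <= b -> cosang g h <= hcos g h (s, t).
Proof.
move=> gg hh a0 b0 ap bq ar br loc.
have lo s t : 0 < s <= a -> 0 < t <= b -> -1 <= hcos g h (s, t).
  move=> /andP[s0 sa] /andP[t0 tb].
  suff /andP[] : -1 <= hcos g h (s, t) <= 1 by [].
  by apply: (hcos_itv gg hh); rewrite ?s0 ?t0 /= ?(le_trans sa) ?(le_trans tb).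
have [C [cC leC]] := monotone_cvg_corner a0 b0 lo (hcos_monotone gg hh ap bq ar br loc).
by rewrite /cosang (cvg_lim _ cC).
Qed.

Lemma cosangC g h : cvg (hcos g h @ corner R) -> cosang h g = cosang g h.
Proof.
move=> /cvg_corner_swap c; rewrite {1}/cosang.
suff -> : hcos h g = (fun st => hcos g h (st.2, st.1)) by exact/cvg_lim.
by apply/funext => -[s t]; rewrite /hcos /= hyp_cosC metric_sym.
Qed.

(** Adjacent angles add up to at most [pi]: [z] is the midpoint of [h1 t] and [h2 t], and there the
    Stewart inequality says that the two comparison cosines have nonnegative sum. *)
Lemma cosang_adjacent z g h1 h2 (r : R) : 0 < r ->
  (forall t, 0 < t -> t < r ->
    [/\ mdist z (g t) = t, mdist z (h1 t) = t, mdist z (h2 t) = t &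
        mdist (h1 t) (h2 t) = t + t]) ->
  (forall s t, 0 < s -> s < r -> 0 < t -> t < r -> stewart (h1 t) (h2 t) z (g s)) ->
  cvg (hcos g h1 @ corner R) -> cvg (hcos g h2 @ corner R) ->
  0 <= cosang g h1 + cosang g h2.
Proof.
move=> r0 dist st c1 c2; rewrite leNgt; apply/negP => neg.
have lt0 : \forall u \near corner R, (hcos g h1 + hcos g h2) u < 0.
  exact: (cvgr_lt _ (cvgD c1 c2) _ neg).
have [[s t] /= [[s0 sr t0 tr]]] := @filter_ex _ (corner R) _ _ (filterI (near_corner r0) lt0).
apply/negP; rewrite -leNgt.
have [zg _ _ _] := dist _ s0 sr; have [_ z1 z2 z12] := dist _ t0 tr.
have := st _ _ s0 sr t0 tr.
rewrite /stewart z12 (metric_sym _ z) z1 z2 (metric_sym _ z) zg => /(_ erefl).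
rewrite -mulrDr sinhD => H.
have {}H : cosh (mdist (g s) (h1 t)) + cosh (mdist (g s) (h2 t)) <=
    cosh s * cosh t + cosh s * cosh t.
  rewrite -(ler_pM2l (sinh_gt0 t0)); apply: le_trans H _.
  by rewrite -subr_ge0; match goal with |- is_true (_ <= ?e) => have -> : e = 0 by ring end.
change (0 <= hcos g h1 (s, t) + hcos g h2 (s, t)).
rewrite /hcos /hyp_cos /= -mulrDl; apply: mulr_ge0.
  by rewrite addrACA -opprD subr_ge0.
by rewrite invr_ge0 mulr_ge0 ?sinh_ge0 ?ltW.
Qed.

End Cosang.

(** * Globalization *)

Section HingeStep.
Context {R : realType}.
Implicit Types a b e u k eta tau l : R.

(* [a], [b] are the sides of a hinge with cosine [k], the node of the new hinge
   is at distance [u] along the side [b], and [e] is its distance to the end of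
   the side [a]. *)
Lemma hinge_step_old a b e u k : 0 <= b ->
  cosh e <= cosh a * cosh u - sinh a * sinh u * k ->
  cosh e * sinh b - cosh a * sinh (b - u) <=
  sinh u * (cosh a * cosh b - sinh a * sinh b * k).
Proof.
move=> /sinh_ge0 b0 H; have := ler_wpM2l b0 H.
by rewrite sinhB; lra.
Qed.

(** The right-hand side, shared with [hinge_step_old], is [sinh u] times the value at [b] of the
    solution of [y'' = y] equal to [cosh a] at 0 and [cosh e] at [u]. The predictions of the old and
    new hinges are compared through it. *)
Lemma hinge_step_new a b e u k1 k2 : 0 <= e -> 0 <= u <= b ->
  cosh a <= cosh e * cosh u - sinh e * sinh u * k1 -> 0 <= k1 + k2 ->
  sinh u * (cosh e * cosh (b - u) - sinh e * sinh (b - u) * k2) <=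
  cosh e * sinh b - cosh a * sinh (b - u).
Proof.
move=> /sinh_ge0 e0 /andP[/sinh_ge0 u0 ub] H kk.
have w0 : 0 <= sinh (b - u) by rewrite sinh_ge0// subr_ge0.
have -> : sinh b = sinh u * cosh (b - u) + cosh u * sinh (b - u).
  by rewrite -sinhD addrC subrK.
have := ler_wpM2l w0 H.
have := mulr_ge0 (mulr_ge0 w0 (mulr_ge0 u0 e0)) kk.
move: (sinh (b - u)) (cosh (b - u)) => sw cw.
by lra.
Qed.

(** For [e = a + u] the right-hand side is exactly [sinh u * cosh (a + b)]; the defect [a + u - e]
    costs [(cosh (a + u) - cosh e) * sinh b], which the hypothesis keeps below [tau * sinh u]. *)
Lemma hinge_step_end a b e u l tau : 0 <= a -> 0 <= b -> 0 < u -> 0 <= e ->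
  e <= a + u -> b <= l -> a + u <= l -> 
  a + u - e <= tau * sinh u / (expR l ^+ 2 * l) ->
  sinh u * (cosh (a + b) - tau) <= cosh e * sinh b - cosh a * sinh (b - u).
Proof.
move=> a0 b0 u0 e0 eau bl aul.
have l0 : 0 < l by lra.
rewrite ler_pdivlMr ?mulr_gt0 ?exprn_gt0 ?expR_gt0// => H.
have -> : cosh e * sinh b - cosh a * sinh (b - u) =
    sinh u * cosh (a + b) - (cosh (a + u) - cosh e) * sinh b.
  by rewrite !coshD sinhB; ring.
suff : (cosh (a + u) - cosh e) * sinh b <= tau * sinh u by lra.
apply: le_trans H.
have h1 : cosh (a + u) - cosh e <= expR l * ((a + u - e) * l).
  apply: le_trans (coshB_le e0 eau) _.
  apply: ler_pM; rewrite ?expR_ge0 ?ler_expR//.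
    rewrite divr_ge0// subr_sqr mulr_ge0//; lra.
  have -> : ((a + u) ^+ 2 - e ^+ 2) / 2 = (a + u - e) * ((a + u + e) / 2) by field.
  by apply: ler_wpM2l; lra.
have h2 : sinh b <= expR l by apply: le_trans (sinh_le_exp b) _; rewrite ler_expR.
have -> : (a + u - e) * (expR l ^+ 2 * l) = expR l * ((a + u - e) * l) * expR l by ring.
by apply: ler_pM => //; [rewrite subr_ge0 ler_cosh//; lra|exact: sinh_ge0].
Qed.

End HingeStep.

Section Globalization.
Context {R : realType} {M : metricType R}.
Implicit Types (p q x y z : M) (g h : R -> M).

Definition hinges_lt (l : R) : Prop := forall x p q g h,
  min_geodesic x p g -> min_geodesic x q h -> x != p -> x != q ->
  mdist x p + mdist x q < l -> hinge x p q g h.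

Variable r : R.
Hypothesis r_gt0 : 0 < r.
Hypothesis local_stewart : forall c x y z p, mdist c x <= r -> mdist c y <= r ->
  mdist c z <= r -> mdist c p <= r -> stewart x y z p.
Hypothesis geo : forall x y, exists g, min_geodesic x y g.

(** Angles only see small scales, so they exist before globalization. *)
Lemma cvg_hcos x p q g h : min_geodesic x p g -> min_geodesic x q h ->
  x != p -> x != q -> cvg (hcos g h @ corner R).
Proof.
rewrite -!mdist_gt0 => gg hh xp xq.
have [//|//|||||//|c _] := @cosang_spec _ _ x p q g h (Num.min r (mdist x p))
  (Num.min r (mdist x q)) r gg hh; rewrite ?lt_min ?ge_min ?r_gt0 ?lexx ?orbT//.
exact: local_stewart.
Qed.

Lemma hinges_lt_local : hinges_lt r.
Proof.
move=> x p q g h gg hh; rewrite -!mdist_gt0 => xp xq pq.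
have [c H] : hcos g h @ corner R --> cosang g h /\
  forall s t, 0 < s <= mdist x p -> 0 < t <= mdist x q -> cosang g h <= hcos g h (s, t).
  by apply: (cosang_spec (r := r) gg hh) => //; [lra|lra|exact: local_stewart].
have := H _ _ _ _; rewrite /hcos /= => /(_ (mdist x p) (mdist x q)).
case: gg hh => _ -> _ [_ -> _]; rewrite hyp_cos_ge//.
by apply; rewrite ?xp ?xq lexx.
Qed.

(** Initial pieces of [h1] and [h2] join to a shortest path through [z], since a shortcut would make
    [x] and [y] closer than the path through [z] allows. So the two angles are adjacent. *)
Lemma cosang_split z x y p g h1 h2 : mdist x z + mdist z y = mdist x y ->
  min_geodesic z x h1 -> min_geodesic z y h2 -> min_geodesic z p g ->
  z != x -> z != y -> z != p -> 0 <= cosang g h1 + cosang g h2.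
Proof.
move=> xzy hh1 hh2 gg zx zy zp.
have [x0 y0 p0] : [/\ 0 < mdist z x, 0 < mdist z y & 0 < mdist z p].
  by rewrite !mdist_gt0.
pose e := Num.min (Num.min r (mdist z p)) (Num.min (mdist z x) (mdist z y)).
have [er ep ex ey] : [/\ e <= r, e <= mdist z p, e <= mdist z x & e <= mdist z y].
  by rewrite /e !ge_min !lexx !orbT.
have dist t : 0 < t -> t < e -> [/\ mdist z (g t) = t, mdist z (h1 t) = t,
    mdist z (h2 t) = t & mdist (h1 t) (h2 t) = t + t].
  move=> t0 te.
  have zg : mdist z (g t) = t by apply: (geo_dist gg); lra.
  have z1 : mdist z (h1 t) = t by apply: (geo_dist hh1); lra.
  have z2 : mdist z (h2 t) = t by apply: (geo_dist hh2); lra.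
  have x1 : mdist (h1 t) x = mdist z x - t by apply: (geo_dist_end hh1); lra.
  have y2 : mdist (h2 t) y = mdist z y - t by apply: (geo_dist_end hh2); lra.
  split => //; apply/le_anti/andP; split.
    by have := metric_triangle (h1 t) z (h2 t); rewrite (metric_sym _ z) z1 z2.
  have := metric_triangle x (h1 t) y; have := metric_triangle (h1 t) (h2 t) y.
  by rewrite -xzy y2 (metric_sym x (h1 t)) x1 (metric_sym x z); lra.
apply: (@cosang_adjacent _ _ z _ _ _ e).
- by rewrite /e !lt_min r_gt0 p0 x0.
- exact: dist.
- move=> s t s0 se t0 te; apply: (local_stewart (c := z)).
  + by have [_ -> _ _] := dist t t0 te; lra.
  + by have [_ _ -> _] := dist t t0 te; lra.
  + by rewrite mdistxx ltW.
  + by have [-> _ _ _] := dist s s0 se; lra.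
- exact: (cvg_hcos gg hh1).
- exact: (cvg_hcos gg hh2).
Qed.

(* Replace the node [x] of a hinge by the point [x'] at distance [l / 18] from
   [x] on the longer side: this does not increase the side predicted by the
   hinge, and either decreases the perimeter of the hinge by a fixed amount, or
   the hinge is almost flat and the triangle inequality suffices. *)
Lemma hinges_lt_step l : 0 < l -> hinges_lt (2 / 3 * l) -> hinges_lt l.
Proof.
move=> l0 IH.
(* The almost flat case only gives the inequality up to an error, so a tolerance is carried and
   removed at the end. *)
suff main : forall tau : R, 0 < tau -> forall x p q g h,
    min_geodesic x p g -> min_geodesic x q h -> x != p -> x != q ->
    mdist x p + mdist x q < l ->
    cosh (mdist p q) - tau <= cosh (mdist x p) * cosh (mdist x q) -
      sinh (mdist x p) * sinh (mdist x q) * cosang g h.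
  move=> x p q g h gg hh xp xq pq; apply/ler_addgt0Pr => tau tau0.
  by rewrite -lerBlDr; exact: main.
move=> tau tau0.
(* If the shorter side is [a <= l / 2], the auxiliary hinges have side sums at most [a + u] and
   [a + 2 * u], both below [2 / 3 * l]. *)
pose u := l / 18; have u0 : 0 < u by rewrite /u; lra.
pose eta := tau * sinh u / (expR l ^+ 2 * l).
have eta0 : 0 < eta.
  by apply: divr_gt0; apply: mulr_gt0 => //; [exact: sinh_gt0|exact/exprn_gt0/expR_gt0].
suff main m x p q g h : min_geodesic x p g -> min_geodesic x q h ->
    x != p -> x != q -> mdist x p + mdist x q < l ->
    mdist x p + mdist x q < 2 / 3 * l + m%:R * eta ->
    cosh (mdist p q) - tau <= cosh (mdist x p) * cosh (mdist x q) -
      sinh (mdist x p) * sinh (mdist x q) * cosang g h.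
  move=> x p q g h gg hh xp xq pq.
  apply: (main (Num.truncn (l / eta)).+1) => //; apply: lt_le_trans pq _.
  have : l / eta < (Num.truncn (l / eta)).+1%:R by exact: truncnS_gt.
  by rewrite ltr_pdivrMr//; lra.
elim: m x p q g h => [|m IHm] x p q g h gg hh xp xq pql.
  by rewrite mul0r addr0 => /(IH _ _ _ _ _ gg hh xp xq); rewrite /hinge; lra.
wlog pq : p q g h gg hh xp xq pql / mdist x p <= mdist x q.
  move=> W; case: (leP (mdist x p) (mdist x q)) => pq; first exact: W.
  rewrite addrC => H; have := W q p h g hh gg xq xp _ (ltW pq) H.
  rewrite (cosangC (cvg_hcos gg hh xp xq)) (metric_sym q).
  rewrite (mulrC (cosh (mdist x q))) (mulrC (sinh (mdist x q))); apply.
  by rewrite addrC.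
move=> pqm.
have [sm|big] := ltP (mdist x p + mdist x q) (2 / 3 * l).
  by have := IH _ _ _ _ _ gg hh xp xq sm; rewrite /hinge; lra.
set a := mdist x p in pql pq pqm big *; set b := mdist x q in pql pq pqm big *.
have a0 : 0 < a by rewrite mdist_gt0.
have ul : u = l / 18 by [].
have ub : 0 < u < b by lra.
have ub' : 0 <= u <= b by lra.
pose x' := h u.
have xx' : mdist x x' = u by apply: (geo_dist hh); exact: ub'.
have x'q : mdist x' q = b - u by exact: (geo_dist_end hh ub').
have nxx' : x != x' by rewrite -mdist_gt0 xx'.
have hinge1 : hinge x p x' g h.
  by apply: IH => //; [exact: geo_head hh ub'|rewrite xx' -/a; lra].
rewrite /hinge xx' -/a in hinge1.
have b0 : 0 <= b by lra.
have old := hinge_step_old b0 (e := mdist p x') hinge1.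
have [e1 e2] : mdist p x' <= a + u /\ a <= mdist p x' + u.
  have := metric_triangle p x x'; have := metric_triangle x x' p.
  by rewrite xx' (metric_sym p x) (metric_sym x' p) -/a; lra.
have su : 0 < sinh u by exact: sinh_gt0.
have e0 : 0 <= mdist p x' by exact: mdist_ge0.
have pqab : mdist p q <= a + b by have := metric_triangle p x q; rewrite (metric_sym p x).
(* If the new node is [p] itself, there is no new hinge: [p] lies on [h] and the distance to [q] is
   known. *)
have [px'|x'p] := eqVneq x' p.
  move: old; rewrite -{1}px' mdistxx cosh0 mul1r => old.
  have au : a = u by rewrite /a -px'.
  have -> : mdist p q = b - u by rewrite -px'.
  apply: le_trans (_ : cosh (b - u) <= _); first lra.
  rewrite -(ler_pM2l su); apply: le_trans old.
  have {2}-> : b = u + (b - u) by lra.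
  by rewrite (sinhD u (b - u)) -au addrK.
have [big_step|small_step] := leP eta (a + u - mdist p x').
  have [g' gg'] := geo x' p.
  have x'xq : mdist x x' + mdist x' q = mdist x q by rewrite xx' x'q addrC subrK.
  have nx'q : x' != q by rewrite -mdist_gt0 x'q; lra.
  have k12 : 0 <= cosang g' (fun s => h (u - s)) + cosang g' (fun s => h (u + s)).
    by apply: (cosang_split x'xq (geo_back hh ub') (geo_tail hh ub') gg') => //; rewrite eq_sym.
  have ge : mdist x' p + mdist x' x < 2 / 3 * l.
    by rewrite (metric_sym x' x) xx' (metric_sym x' p); clear -l0 e1 ul pq pql; lra.
  have hinge2 : hinge x' p x g' (fun s => h (u - s)).
    by apply: IH => //; [exact: geo_back hh ub'|rewrite eq_sym].
  rewrite /hinge (metric_sym x' x) xx' (metric_sym p x) (metric_sym x' p) -/a in hinge2.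
  have new := hinge_step_new e0 ub' hinge2 k12.
  rewrite -(ler_pM2l su); apply: le_trans old; apply: le_trans new.
  rewrite (ler_pM2l su).
  have := @IHm x' p q g' (fun s => h (u + s)) gg' (geo_tail hh ub') x'p.
  rewrite -mdist_gt0 x'q (metric_sym x' p).
  move: pqm; rewrite -[m.+1%:R]natr1 => pqm.
  by clear -big_step pql pqm e1 ul ub; apply; lra.
rewrite -(ler_pM2l su); apply: le_trans old.
have e := @hinge_step_end R a b (mdist p x') u l tau.
apply: le_trans (e _ _ _ _ _ _ _ _); rewrite ?(ltW a0)//;
  [|by clear -a0 pql; lra|by clear -a0 pq pql ul; lra|exact: ltW].
by rewrite (ler_pM2l su) lerB// ler_cosh// ?mdist_ge0// addr_ge0// ltW.
Qed.

(** Each step enlarges the admissible side sum by the factor [3 / 2], starting from the local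
    radius. *)
Lemma all_hinges x p q g h : min_geodesic x p g -> min_geodesic x q h ->
  x != p -> x != q -> hinge x p q g h.
Proof.
have H k : hinges_lt ((3 / 2) ^+ k * r).
  elim: k => [|k IH]; first by rewrite expr0 mul1r; exact: hinges_lt_local.
  apply: hinges_lt_step; first by rewrite mulr_gt0// exprn_gt0.
  by have -> : 2 / 3 * ((3 / 2) ^+ k.+1 * r) = (3 / 2) ^+ k * r by rewrite exprS; field.
have bern k : k%:R / 2 <= (3 / 2) ^+ k :> R /\ 1 <= (3 / 2) ^+ k :> R.
  elim: k => [|k [IH1 IH2]]; first by rewrite expr0; split; lra.
  by rewrite exprS -[k.+1%:R]natr1; split; lra.
move=> gg hh xp xq; set S := mdist x p + mdist x q.
pose N := (Num.truncn (2 * S / r)).+1.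
have : 2 * S / r < N%:R by exact: truncnS_gt.
rewrite ltr_pdivrMr// => Sr; apply: (H N) => //.
have [kE _] := bern N.
have : N%:R / 2 * r <= (3 / 2) ^+ N * r by rewrite ler_pM2r.
by rewrite -/S; lra.
Qed.

(** The two angles at [z] are adjacent, and by the hinge comparison their cosines are at most the
    comparison cosines, whose sum is therefore nonnegative. *)
Lemma global_stewart x y z p : stewart x y z p.
Proof.
have [->|xz] := eqVneq x z; first by have [] := stewart_refl z y p.
have [->|yz] := eqVneq y z; first by have [] := stewart_refl x z p.
move=> xzy.
have [<-|zp] := eqVneq z p.
  by rewrite -xzy mdistxx (metric_sym z x) sinhD cosh0; lra.
have [[g gg] [h1 hh1] [h2 hh2]] := And3 (geo z p) (geo z x) (geo z y).
have [zx zy] : z != x /\ z != y by rewrite ![z == _]eq_sym.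
have k12 := cosang_split xzy hh1 hh2 gg zx zy zp.
have H1 := all_hinges gg hh1 zp zx; have H2 := all_hinges gg hh2 zp zy.
rewrite -xzy (metric_sym x z) (metric_sym p z); apply: stewart_of_angles.
- by rewrite mdist_gt0.
- by rewrite mdist_gt0.
- by rewrite mdist_gt0.
- apply: le_trans k12 (lerD _ _).
  + by rewrite hyp_cosC hyp_cos_ge ?mdist_gt0.
  + by rewrite hyp_cosC hyp_cos_ge ?mdist_gt0.
Qed.

End Globalization.

(** * Angles and contractions in Alexandrov spaces *)

Section EuclideanAngle.
Context {R : realType}.
Implicit Types a b c d e s t : R.

(* With [A = |s - t|] and [B = s + t], both [1 - cos] are of the form
   [2 (f d - f A) / (f B - f A)], for [f = cosh] and for [f = ^2 / 2]. *)
Lemma eucl_hyp_cos s t d : 0 < s -> 0 < t -> `|s - t| <= d -> d <= s + t ->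
  `|(s ^+ 2 + t ^+ 2 - d ^+ 2) / (2 * s * t) - hyp_cos s t d| <= 2 * (expR (s + t) - 1).
Proof.
move=> s0 t0 dA dB; set A := `|s - t| in dA; set B := s + t in dB *.
have A0 : 0 <= A by exact: normr_ge0.
have AA : A ^+ 2 = (s - t) ^+ 2 by rewrite real_normK// num_real.
have cA : cosh A = cosh (s - t).
  by rewrite /A; case: (ger0P (s - t)) => // _; rewrite coshN.
have st0 : 0 < s * t by exact: mulr_gt0.
have AB : A <= B by lra.
set E := expR B; have E1 : 1 <= E by rewrite -expR0 ler_expR; lra.
have := coshB_ge A0 dA; have := coshB_le A0 dA.
have := coshB_ge A0 AB; have := coshB_le A0 AB.
rewrite AA.
have -> : (B ^+ 2 - (s - t) ^+ 2) / 2 = 2 * (s * t) by rewrite /B; field.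
set p := (d ^+ 2 - (s - t) ^+ 2) / 2; set q := 2 * (s * t).
set P := cosh d - cosh A; set Q := cosh B - cosh A => QE qQ PE pP.
have q0 : 0 < q by rewrite /q; lra.
have Q0 : 0 < Q by exact: lt_le_trans qQ.
have p0 : 0 <= p.
  rewrite /p divr_ge0// -AA subr_sqr mulr_ge0//; lra.
have pq : p <= q.
  have : d ^+ 2 <= B ^+ 2 by rewrite lerXn2r ?nnegrE; lra.
  by rewrite /p /q /B !expr2; lra.
have {PE}PE : P <= E * p.
  apply: le_trans PE _; apply: ler_wpM2r => //.
  by rewrite ler_expR.
have -> : (s ^+ 2 + t ^+ 2 - d ^+ 2) / (2 * s * t) = 1 - 2 * (p / q).
  by rewrite /p /q; field; rewrite !gt_eqF.
have -> : hyp_cos s t d = 1 - 2 * (P / Q).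
  have ss := sinh_gt0 s0; have st := sinh_gt0 t0.
  have -> : Q = 2 * (sinh s * sinh t) by rewrite /Q cA /B (coshD s t) (coshB s t); ring.
  rewrite /hyp_cos /P cA (coshB s t); field.
  by rewrite !gt_eqF.
(* Both quotients lie in [0, 1] and each is at most [E] times the other, so they differ by at most
   [E - 1]. *)
have h1 : P / Q <= E * (p / q).
  rewrite ler_pdivrMr// mulrA mulrAC ler_pdivlMr//.
  by apply: ler_pM => //; [exact: le_trans pP|exact: ltW].
have h2 : p / q <= E * (P / Q).
  have pQ : p * Q <= P * (E * q) by apply: ler_pM => //; exact: ltW.
  rewrite ler_pdivrMr// -(ler_pM2r Q0).
  by have -> : E * (P / Q) * q * Q = P * (E * q) by field; rewrite gt_eqF.
have h3 : p / q <= 1 by rewrite ler_pdivrMr// mul1r.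
have h4 : 0 <= p / q by rewrite divr_ge0// ltW.
have h5 : P / Q <= 1.
  rewrite ler_pdivrMr// mul1r lerB// ler_cosh//; lra.
move: (P / Q) (p / q) h1 h2 h3 h4 h5 => U V *.
have : (E - 1) * (1 - V) >= 0 by apply: mulr_ge0; lra.
have : (E - 1) * (1 - U) >= 0 by apply: mulr_ge0; lra.
by rewrite ler_norml; lra.
Qed.

Lemma acos_anti a b : -1 <= a <= 1 -> -1 <= b <= 1 -> (acos a < acos b) = (b < a).
Proof.
move=> a1 b1; rewrite -ltr_cos ?in_itv/= ?acos_ge0 ?acos_lepi//.
by rewrite !acosK ?in_itv.
Qed.

Lemma acos_continuous_itv a e : -1 <= a <= 1 -> 0 < e ->
  exists2 eta, 0 < eta & forall b, -1 <= b <= 1 -> `|a - b| < eta ->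
    `|acos a - acos b| < e.
Proof.
move=> a1 e0; have [t0 tpi] := (acos_ge0 a1, acos_lepi a1).
have [eta1 h1 H1] : exists2 eta, 0 < eta & forall b, -1 <= b <= 1 -> a - b < eta ->
    acos b < acos a + e.
  case: (leP (acos a + e) pi) => te; last first.
    by exists 1 => // b b1 _; apply: le_lt_trans te; exact: acos_lepi.
  have cosin : -1 <= cos (acos a + e) <= 1 by rewrite cos_geN1 cos_le1.
  have tin : acos a + e \in `[0, pi] by rewrite in_itv/= te andbT; lra.
  exists (a - cos (acos a + e)).
    rewrite subr_gt0 -{2}[a]acosK ?in_itv// ltr_cos// ?in_itv/= ?t0//; lra.
  move=> b b1; rewrite ltrD2l ltrN2 => lt.
  by rewrite -[X in _ < X]cosK// acos_anti.
have [eta2 h2 H2] : exists2 eta, 0 < eta & forall b, -1 <= b <= 1 -> b - a < eta ->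
    acos a - e < acos b.
  case: (leP 0 (acos a - e)) => te; last first.
    by exists 1 => // b b1 _; apply: lt_le_trans te _; exact: acos_ge0.
  have cosin : -1 <= cos (acos a - e) <= 1 by rewrite cos_geN1 cos_le1.
  have tin : acos a - e \in `[0, pi] by rewrite in_itv/= te/=; lra.
  exists (cos (acos a - e) - a).
    rewrite subr_gt0 -{1}[a]acosK ?in_itv// ltr_cos// ?in_itv/= ?t0//; lra.
  move=> b b1; rewrite ltrD2r => lt.
  by rewrite -[X in X < _]cosK// acos_anti.
exists (Num.min eta1 eta2) => [|b b1]; first by rewrite lt_min h1.
rewrite lt_min !ltr_norml => /andP[/andP[_ ab1] /andP[ab2 _]].
by have := H1 b b1 ab1; have := H2 b b1 _; rewrite ltrBlDr -ltrBlDl; lra.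
Qed.

End EuclideanAngle.

(** * Global comparison, angles and contraction for compact spaces *)

Section Consequences.
Context {R : realType} {M : metricType R}.
Hypothesis alexM : compact_alexandrov_ge_N1 M.
Implicit Types (p q x y z : M) (g h : R -> M).

Lemma alexandrov_geo x y : exists g, min_geodesic x y g.
Proof. by case: alexM => cM iM _; exact: geodesic_exists. Qed.

Let local_radius : exists2 r : R, 0 < r & forall c x y z p, mdist c x <= r ->
  mdist c y <= r -> mdist c z <= r -> mdist c p <= r -> stewart x y z p.
Proof.
case: alexM => cM _ curv; have [r r0 rP] := uniform_stewart cM curv.
exists (r / 2); first lra.
by move=> c x y z p xr yr zr pr; apply: (rP c); apply: le_lt_trans (_ : _ <= r / 2) _ => //; lra.
Qed.

Lemma alexandrov_stewart x y z p : stewart x y z p.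
Proof. by have [r r0 rP] := local_radius; exact: global_stewart r0 rP alexandrov_geo _ _ _ _. Qed.

Lemma alexandrov_hinge x p q g h : min_geodesic x p g -> min_geodesic x q h ->
  x != p -> x != q -> hinge x p q g h.
Proof. by have [r r0 rP] := local_radius; exact: all_hinges r0 rP alexandrov_geo _ _ _ _ _. Qed.

Lemma alexandrov_cosang x p q g h : min_geodesic x p g -> min_geodesic x q h ->
  x != p -> x != q -> hcos g h @ corner R --> cosang g h.
Proof.
move=> gg hh; rewrite -!mdist_gt0 => xp xq.
have pS : mdist x p <= mdist x p + mdist x q by lra.
have qS : mdist x q <= mdist x p + mdist x q by lra.
by have [] := cosang_spec gg hh xp xq (lexx _) (lexx _) pS qS
  (fun x' y' z' p' _ _ _ _ => @alexandrov_stewart x' y' z' p').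
Qed.

Lemma cosang_itv x p q g h : min_geodesic x p g -> min_geodesic x q h ->
  x != p -> x != q -> -1 <= cosang g h <= 1.
Proof.
move=> gg hh xp xq; have cv := alexandrov_cosang gg hh xp xq.
have e0 : 0 < Num.min (mdist x p) (mdist x q) by rewrite lt_min !mdist_gt0 xp.
have itv : \forall st \near corner R, -1 <= hcos g h st <= 1.
  apply: filterS (near_corner e0) => -[s t] /= [s0]; rewrite lt_min => /andP[sp _] t0.
  rewrite lt_min => /andP[_ tq].
  by apply: (hcos_itv gg hh); rewrite ?s0 ?t0 ltW.
apply/andP; split.
  by apply: limr_ge; [exact: cvgP cv|apply: filterS itv => st /andP[]].
by apply: limr_le; [exact: cvgP cv|apply: filterS itv => st /andP[]].
Qed.

(** [angle] is a limit of Euclidean comparison angles; by [eucl_hyp_cos] their cosines have the same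
    limit as the hyperbolic ones, and [acos] is continuous on the closed interval. *)
Lemma angle_acos x p q g h : min_geodesic x p g -> min_geodesic x q h ->
  x != p -> x != q -> angle x g h = acos (cosang g h).
Proof.
move=> gg hh xp xq; have cv := alexandrov_cosang gg hh xp xq.
have C1 := cosang_itv gg hh xp xq.
apply: norm_cvg_lim; apply/cvgrPdist_lt => e e0.
have [eta eta0 acosP] := acos_continuous_itv C1 e0.
have l0 : 0 < ln (1 + eta / 4) / 2 by rewrite divr_gt0// ln_gt0//; lra.
pose r := Num.min (ln (1 + eta / 4) / 2) (Num.min (mdist x p) (mdist x q)).
have r0 : 0 < r by rewrite !lt_min !mdist_gt0 xp xq l0.
have eta2 : 0 < eta / 2 by lra.
have near1 : \forall st \near corner R, `|cosang g h - hcos g h st| < eta / 2.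
  by move/cvgrPdist_lt : cv; exact.
apply: filterS2 (near_corner r0) near1 => -[s t] /= [s0]; rewrite !lt_min.
move=> /andP[sl /andP[sp _]] t0 /andP[tl /andP[_ tq]] st_near.
have xs : mdist x (g s) = s by apply: (geo_dist gg); rewrite !ltW.
have xt : mdist x (h t) = t by apply: (geo_dist hh); rewrite !ltW.
rewrite /eucl_angle xs xt; set d := mdist (g s) (h t).
have dA : `|s - t| <= d by rewrite -{1}xs -xt mdist_triB.
have dB : d <= s + t by rewrite -[X in _ <= X + _]xs -[X in _ <= _ + X]xt (metric_sym x (g s)) metric_triangle.
have := eucl_hyp_cos s0 t0 dA dB.
have E : expR (s + t) < 1 + eta / 4.
  by rewrite -[ltRHS]lnK ?ltr_expR ?posrE; lra.
move=> close; apply: acosP; last first.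
  have -> : eta = eta / 2 + eta / 2 by lra.
  apply: le_lt_trans (ler_distD (hyp_cos s t d) _ _) _; apply: ltrD => //.
  by rewrite distrC; apply: le_lt_trans close _; lra.
have st0 : 0 < 2 * s * t by rewrite !mulr_gt0.
rewrite ler_pdivlMr// ler_pdivrMr//.
have d0 : 0 <= d by exact: mdist_ge0.
have : (s - t) ^+ 2 <= d ^+ 2.
  by rewrite -[(s - t) ^+ 2]real_normK ?num_real// lerXn2r// nnegrE.
have : d ^+ 2 <= (s + t) ^+ 2 by rewrite lerXn2r// nnegrE addr_ge0// ltW.
by rewrite !expr2; lra.
Qed.

(* [1 - cos] of the comparison angle does not decrease under contraction, and
   [cosh d - 1] is comparable to [(a - b)^2 / 2 + a b (1 - cos)]. *)
Lemma alexandrov_contraction (D : R) z x y g h t : (forall u v : M, mdist u v <= D) ->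
  min_geodesic z x g -> min_geodesic z y h -> 0 <= t <= 1 ->
  t * mdist x y <= expR D ^+ 2 * mdist (g (t * mdist z x)) (h (t * mdist z y)).
Proof.
move=> diamD gg hh /andP[t0 t1].
have D0 : 0 <= D by exact: le_trans (mdist_ge0 z x) (diamD _ _).
set K := expR D; have K1 : 1 <= K by rewrite -expR0 ler_expR.
have K0 : 0 <= K by exact: le_trans K1.
have K2 : 1 <= K ^+ 2 by exact: exprn_ege1.
have [->|tn0] := eqVneq t 0; first by rewrite mul0r mulr_ge0 ?exprn_ge0 ?mdist_ge0.
have {}t0 : 0 < t by rewrite lt_neqAle eq_sym tn0.
have scaled q f : min_geodesic z q f -> mdist z (f (t * mdist z q)) = t * mdist z q.
  move=> ff; have q0 := mdist_ge0 z q.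
  by apply: (geo_dist ff); rewrite mulr_ge0 ?(ltW t0)// ler_piMl.
have KM u : 0 <= u -> u <= K ^+ 2 * u by move=> u0; rewrite ler_peMl.
have tge0 q : 0 <= t * mdist z q by rewrite mulr_ge0 ?(ltW t0) ?mdist_ge0.
have [zx|zx] := eqVneq z x.
  by rewrite -zx mdistxx mulr0; case: gg => -> _ _; rewrite (scaled _ _ hh) KM.
have [zy|zy] := eqVneq z y.
  rewrite -zy mdistxx mulr0; case: hh => -> _ _.
  by rewrite (metric_sym (g _) z) (scaled _ _ gg) (metric_sym x z) KM.
rewrite -mdist_gt0 in zx; rewrite -mdist_gt0 in zy.
set a := mdist z x in zx *; set b := mdist z y in zy *; set d := mdist x y.
set dt := mdist (g (t * a)) (h (t * b)).
have [aD bD] : a <= D /\ b <= D by split; exact: diamD.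
have ta : 0 < t * a by exact: mulr_gt0.
have tb : 0 < t * b by exact: mulr_gt0.
have mono : hyp_cos (t * a) (t * b) dt <= hyp_cos a b d.
  have := @hcos_monotone _ _ z x y g h a b D gg hh (lexx _) (lexx _) aD bD
    (fun x' y' z' p' _ _ _ _ => @alexandrov_stewart x' y' z' p')
    (t * a) a (t * b) b ta _ (lexx _) tb _ (lexx _).
  rewrite /hcos /=; case: (gg) (hh) => _ -> _ [_ -> _].
  by apply; rewrite ler_piMl// ltW.
have k1 : hyp_cos a b d <= 1.
  suff /andP[] : -1 <= hyp_cos a b d <= 1 by [].
  by apply: hyp_cos_mdist; rewrite -mdist_gt0.
have sd := hyp_cos_side d zx zy; have sdt := hyp_cos_side dt ta tb.
move: (hyp_cos (t * a) (t * b) dt) (hyp_cos a b d) mono k1 sd sdt => kt k mono k1 sd sdt.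
have d0 : 0 <= d by exact: mdist_ge0.
have dt0 : 0 <= dt by exact: mdist_ge0.
(* Half the squared third side of the Euclidean hinge with sides [a], [b] and cosine [k]; it links
   [d] to [dt]. *)
pose w := (a - b) ^+ 2 / 2 + a * b * (1 - k).
have ab0 : 0 <= a * b by rewrite mulr_ge0 ?ltW.
have up : d ^+ 2 / 2 <= K ^+ 2 * w.
  have c1 : d ^+ 2 / 2 <= cosh d - 1.
    by have := coshB_ge (lexx 0) d0; rewrite cosh0 expr0n subr0.
  have c2 : cosh (a - b) - 1 <= K ^+ 2 * ((a - b) ^+ 2 / 2).
    have -> : cosh (a - b) = cosh `|a - b|.
      by case: (ger0P (a - b)) => // _; rewrite coshN.
    have := coshB_le (lexx 0) (normr_ge0 (a - b)).
    rewrite cosh0 expr0n subr0 real_normK ?num_real// => /le_trans; apply.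
    apply: ler_wpM2r; first by rewrite divr_ge0// sqr_ge0.
    apply: (@le_trans _ _ K); last by rewrite expr2 ler_peMl.
    by rewrite ler_expR ler_norml; lra.
  have c3 : sinh a * sinh b <= K ^+ 2 * (a * b).
    have sa : sinh a <= a * K.
      by apply: le_trans (sinh_le (ltW zx)) _; rewrite ler_pM2l// ler_expR.
    have sb : sinh b <= b * K.
      by apply: le_trans (sinh_le (ltW zy)) _; rewrite ler_pM2l// ler_expR.
    have -> : K ^+ 2 * (a * b) = (a * K) * (b * K) by ring.
    by apply: ler_pM => //; rewrite sinh_ge0// ltW.
  have c4 : sinh a * sinh b * (1 - k) <= K ^+ 2 * (a * b) * (1 - k).
    by apply: ler_wpM2r c3; lra.
  by rewrite coshB in c2; rewrite /w; lra.
have lo : t ^+ 2 * w <= K * (dt ^+ 2 / 2).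
  have c1 : cosh dt - 1 <= K * (dt ^+ 2 / 2).
    have := coshB_le (lexx 0) dt0; rewrite cosh0 expr0n subr0 => /le_trans; apply.
    by apply: ler_wpM2r; [rewrite divr_ge0// sqr_ge0|rewrite ler_expR diamD].
  have c2 : t ^+ 2 * ((a - b) ^+ 2 / 2) <= cosh (t * a - t * b) - 1.
    have -> : cosh (t * a - t * b) = cosh `|t * a - t * b|.
      by case: (ger0P (t * a - t * b)) => // _; rewrite coshN.
    have := coshB_ge (lexx 0) (normr_ge0 (t * a - t * b)).
    rewrite cosh0 expr0n subr0 real_normK ?num_real// => /(le_trans _); apply.
    by rewrite -mulrBr exprMn mulrA.
  have c3 : t ^+ 2 * (a * b) <= sinh (t * a) * sinh (t * b).
    have -> : t ^+ 2 * (a * b) = (t * a) * (t * b) by ring.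
    by apply: ler_pM; [exact: ltW|exact: ltW|exact/sinh_ge/ltW|exact/sinh_ge/ltW].
  have c4 : t ^+ 2 * (a * b) * (1 - k) <= sinh (t * a) * sinh (t * b) * (1 - kt).
    by apply: ler_pM => //; [exact: mulr_ge0 (sqr_ge0 _) ab0|lra|lra].
  by rewrite coshB in c2; rewrite /w; lra.
(* The two bounds lose [K ^+ 3], rounded up to [K ^+ 4] to have a square. *)
have sq : (t * d) ^+ 2 <= (K ^+ 2 * dt) ^+ 2.
  apply: (@le_trans _ _ (K ^+ 2 * (K * dt ^+ 2))).
    have := ler_wpM2l (sqr_ge0 t) up.
    have := ler_wpM2l (exprn_ge0 2 K0) lo.
    by rewrite exprMn; lra.
  rewrite exprMn mulrA -exprSr ler_wpM2r ?sqr_ge0//.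
  by rewrite -exprM; apply: ler_weXn2l.
have td0 : 0 <= t * d by apply: mulr_ge0 => //; exact: ltW.
have Kd0 : 0 <= K ^+ 2 * dt by apply: mulr_ge0 => //; exact: exprn_ge0.
by rewrite -(@ler_pXn2r _ 2) ?nnegrE.
Qed.

End Consequences.

(** * Packing and Hausdorff measure *)

Section HausdorffLowerBound.
Context {R : realType} {M : metricType R}.

Lemma mdist_diam (U : set M) x y : U x -> U y -> ((mdist x y)%:E <= diam U)%E.
Proof.
move=> Ux Uy; rewrite /diam le_max; apply/orP; right.
by apply: ereal_sup_ubound; exists (x, y).
Qed.

Lemma diam_ge0 (U : set M) : (0 <= diam U)%E.
Proof. by rewrite /diam le_max lexx. Qed.

Lemma small_cover (s c : R) : 0 < c -> hausdorff_measure s [set: M] = 0%E ->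
  exists U : nat -> set M, [/\ forall x, exists i, U i x,
    forall i, (diam (U i) <= 1%:E)%E &
    (\sum_(0 <= i <oo) poweR (diam (U i)) s < c%:E)%E].
Proof.
move=> c0 H0.
have : (hausdorff_content s 1 [set: M] < c%:E)%E.
  apply: (@le_lt_trans _ _ 0%E); last by rewrite lte_fin.
  by rewrite -H0; apply: ereal_sup_ubound; exists 1 => //=.
move=> /ereal_inf_lt[_ [U [cov dU] <-] lt]; exists U; split => //.
by move=> x; have [//|i _ ?] := cov x; exists i.
Qed.

Lemma sum_at_most_one (T : finType) (b : pred T) (B : bool) (w : \bar R) :
  (0 <= w)%E -> (forall j, b j -> B) -> (forall i j, b i -> b j -> i = j) ->
  (\sum_(j : T) (if b j then w else 0) <= if B then w else 0)%E.
Proof.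
move=> w0 bB b1; case: (pickP b) => [j0 bj0|nb].
  rewrite (bB _ bj0) (bigD1 j0)//= bj0 big1 ?adde0// => j jj0.
  by case: ifP => // bj; rewrite (b1 _ _ bj bj0) eqxx in jj0.
by rewrite big1 => [|j _]; [case: ifP|rewrite nb].
Qed.

(* A self-similar family of nested balls forces positive Hausdorff measure: in
   a cover of small total weight, one can descend to ever smaller balls met only
   by members of the cover of ever smaller total weight. *)
Lemma nested_balls_measure (T : finType) (x0 : M) (lam r0 s : R) :
  compact [set: M] -> 0 < s -> 0 < lam -> lam <= 1 / 2 -> 0 < r0 ->
  1 <= #|T|%:R * lam `^ s ->
  (forall k z, mdist x0 z <= 2 * r0 -> exists f : T -> M,
    (forall i, mdist z (f i) <= r0 * lam ^+ k / 2) /\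
    (forall i j, i != j -> 4 * (r0 * lam ^+ k.+1) <= mdist (f i) (f j))) ->
  hausdorff_measure s [set: M] <> 0%E.
Proof.
move=> cM s0 lam0 lam12 r00 NT config H0.
pose rad k := r0 * lam ^+ k.
have rad0 k : 0 < rad k by rewrite mulr_gt0// exprn_gt0.
have radS k : rad k.+1 <= rad k / 2.
  rewrite /rad exprSr mulrA.
  by have := ler_wpM2l (ltW (rad0 k)) lam12; rewrite /rad; lra.
pose c k := (2 * rad k.+1) `^ s.
have c0 k : 0 < c k by rewrite powR_gt0// mulr_gt0.
have cS k : c k.+1 = lam `^ s * c k.
  have r0' : 0 <= 2 * rad k.+1 by rewrite mulr_ge0// ltW.
  rewrite /c -(powRM s (ltW lam0) r0').
  by congr powR; rewrite /rad (exprS lam k.+1); ring.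
have [U [cov dU wU]] := small_cover (divr_gt0 (c0 0%N) (ltr0n R 2)) H0.
pose eta := c 0%N / 2.
have eta0 : 0 < eta by rewrite /eta divr_gt0.
(* The added summable term makes every weight positive, even for members of diameter 0; the final
   contradiction needs this. *)
pose w i := (poweR (diam (U i)) s + (eta / (2 ^ i.+1)%:R)%:E)%E.
have w_gt0 i : (0 < w i)%E.
  rewrite /w; apply: (@lt_le_trans _ _ (eta / (2 ^ i.+1)%:R)%:E).
    by rewrite lte_fin divr_gt0// ltr0n expn_gt0.
  by rewrite leeDr// poweR_ge0.
have w_ge0 i : (0 <= w i)%E by exact: ltW.
have sum_w : (\sum_(0 <= i <oo) w i < (c 0%N)%:E)%E.
  have eta_ge0 : 0 <= eta by exact: ltW.
  apply: le_lt_trans (epsilon_trick xpredT (fun i => poweR_ge0 _ _) eta_ge0) _.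
  have -> : (c 0%N)%:E = ((c 0%N / 2)%:E + eta%:E)%E.
    by rewrite -EFinD /eta; congr EFin; lra.
  by rewrite lteD2rE.
pose meets z r i := `[< exists2 y, U i y & mdist z y <= r >].
pose S z r := (\sum_(0 <= i <oo) (if meets z r i then w i else 0))%E.
have S_ge z r i : meets z r i -> (w i <= S z r)%E.
  move=> mi; rewrite /S (nneseriesD1 (n := i))//; last by move=> k _; case: ifP.
  by rewrite mi leeDl// nneseries_ge0// => k _; case: ifP.
have step k z : mdist x0 z <= 2 * r0 -> (S z (rad k) < (c k)%:E)%E ->
    exists z', mdist z z' <= rad k / 2 /\ (S z' (rad k.+1) < (c k.+1)%:E)%E.
  move=> xz Sz; have [f [fz fsep]] := config k z xz.
  (* A member weighing less than [c k] has diameter below [2 * rad k.+1], too small to meet two of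
     the balls of the next level. The weight is thus split among these balls, and one of them gets
     less than [c k.+1]. *)
  have small i : meets z (rad k) i -> (diam (U i) < (2 * rad k.+1)%:E)%E.
    move=> mi; have := le_lt_trans (S_ge _ _ _ mi) Sz.
    have fin : diam (U i) \is a fin_num.
      by rewrite ge0_fin_numE ?diam_ge0//; apply: le_lt_trans (dU i) (ltry _).
    have d0 : 0 <= fine (diam (U i)) by rewrite fine_ge0// diam_ge0.
    rewrite /w -(fineK fin) poweR_EFin -EFinD !lte_fin => lt.
    rewrite ltNge; apply/negP => ge.
    have : c k <= fine (diam (U i)) `^ s.
      by rewrite /c ge0_ler_powR// ?nnegrE ?(ltW s0)// mulr_ge0// ltW.
    have : 0 < eta / (2 ^ i.+1)%:R by rewrite divr_gt0// ltr0n expn_gt0.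
    by lra.
  have meets_sub i j : meets (f j) (rad k.+1) i -> meets z (rad k) i.
    move=> /asboolP[y Uy yf]; apply/asboolP; exists y => //.
    have := metric_triangle z (f j) y; have := fz j; have := radS k.
    by rewrite -/(rad k); lra.
  have meets_uniq i j j' : meets (f j) (rad k.+1) i -> meets (f j') (rad k.+1) i -> j = j'.
    move=> mj mj'; apply/eqP; apply: contraT => jj'.
    have d := small i (meets_sub _ _ mj).
    move: mj mj' => /asboolP[y Uy yf] /asboolP[y' Uy' yf'].
    have := le_lt_trans (mdist_diam Uy Uy') d; rewrite lte_fin.
    have := fsep _ _ jj'; rewrite -/(rad k.+1).
    have := metric_triangle (f j) y (f j'); have := metric_triangle y y' (f j').
    by rewrite (metric_sym y' (f j')); lra.
  have sumS : (\sum_(j : T) S (f j) (rad k.+1) <= S z (rad k))%E.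
    rewrite /S -nneseries_sum; last by move=> *; case: ifP.
    apply: lee_nneseries => [i _ _|i _].
      by apply: sume_ge0 => j _; case: ifP.
    apply: (sum_at_most_one (b := fun j => meets (f j) (rad k.+1) i)) => //.
      by move=> j; exact: meets_sub.
    by move=> j j'; exact: meets_uniq.
  apply: contrapT => no.
  have big j : ((c k.+1)%:E <= S (f j) (rad k.+1))%E.
    by rewrite leNgt; apply/negP => lt; apply: no; exists (f j).
  have : ((c k)%:E <= \sum_(j : T) S (f j) (rad k.+1))%E.
    apply: (@le_trans _ _ (\sum_(j : T) (c k.+1)%:E)%E); last exact: lee_sum.
    rewrite sumEFin lee_fin sumr_const cS -[X in _ <= X]mulr_natl mulrA.
    by rewrite ler_peMl// ltW.
  by move=> /le_trans/(_ sumS); rewrite leNgt Sz.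
have /choice[next nextP] : forall kz : nat * M, exists z', mdist x0 kz.2 <= 2 * r0 ->
    (S kz.2 (rad kz.1) < (c kz.1)%:E)%E ->
    mdist kz.2 z' <= rad kz.1 / 2 /\ (S z' (rad kz.1.+1) < (c kz.1.+1)%:E)%E.
  move=> [k z] /=; case: (pselect (mdist x0 z <= 2 * r0 /\ (S z (rad k) < (c k)%:E)%E)).
    by move=> [xz Sz]; have [z' ?] := step k z xz Sz; exists z'.
  by move=> no; exists z => xz Sz; exfalso; exact: no.
pose z := fix z k := if k is k'.+1 then next (k', z k') else x0.
have inv k : mdist x0 (z k) <= 2 * r0 - 2 * rad k /\ (S (z k) (rad k) < (c k)%:E)%E.
  elim: k => [|k [xz Sz]].
    split; first by rewrite /= mdistxx /rad expr0; lra.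
    apply: le_lt_trans sum_w; apply: lee_nneseries => [i _ _|i _]; by case: ifP.
  have xz' : mdist x0 (z k) <= 2 * r0 by have := rad0 k; lra.
  have [zz Sz'] := nextP (k, z k) xz' Sz; split => //=.
  have := metric_triangle x0 (z k) (next (k, z k)); have := radS k.
  by move: zz => /=; lra.
have zS k : mdist (z k) (z k.+1) <= rad k / 2.
  have [xz Sz] := inv k; have xz' : mdist x0 (z k) <= 2 * r0 by have := rad0 k; lra.
  by have [] := nextP (k, z k) xz' Sz.
have zdist k m : mdist (z k) (z (k + m)%N) <= rad k - rad (k + m)%N.
  elim: m => [|m IH]; first by rewrite addn0 mdistxx subrr.
  rewrite addnS; have := metric_triangle (z k) (z (k + m)%N) (z (k + m).+1).
  by have := zS (k + m)%N; have := radS (k + m)%N; lra.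
have [x [_ clx]] := cM (z @ \oo) _ filterT.
have zx k : mdist (z k) x <= rad k.
  apply/ler_addgt0Pr => e e0.
  have /clx/(_ (nbhsx_ballx x e e0)) : (z @ \oo) [set z m | m in [set m | (k <= m)%N]].
    by exists k => // m km /=; exists m.
  move=> [_ [[m km <-]]]; rewrite ballEmdist /= => xzm.
  have := zdist k (m - k)%N; rewrite subnKC// => zm.
  have := metric_triangle (z k) (z m) x; rewrite (metric_sym (z m)).
  by have := rad0 m; lra.
(* The member containing the limit point meets every chosen ball, so its positive weight is below
   every [c k], while [c k] tends to 0. *)
have [i Uix] := cov x.
have small k : (w i < (c k)%:E)%E.
  have [_ Sz] := inv k; apply: le_lt_trans (S_ge _ _ _ _) Sz.
  by apply/asboolP; exists x.
have wfin : w i \is a fin_num by rewrite ge0_fin_numE//; apply: lt_trans (small 0%N) (ltry _).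
have ck k : c k = c 0%N * (lam `^ s) ^+ k.
  by elim: k => [|k IH]; rewrite ?expr0 ?mulr1// cS IH exprS; ring.
have q1 : `|lam `^ s| < 1.
  have lam1 : lam < 1 by lra.
  have := @gt0_ltr_powR _ s s0 lam 1 _ _ lam1.
  by rewrite powR1 ger0_norm ?powR_ge0//; apply; rewrite nnegrE// ltW.
have cvg0 : (fun k => c 0%N * (lam `^ s) ^+ k) @ \oo --> (0 : R).
  by rewrite -(mulr0 (c 0%N)); apply: cvgMr; exact: cvg_expr.
have w0 : 0 < fine (w i) by rewrite fine_gt0// w_gt0 /=; apply: lt_trans (small 0%N) (ltry _).
have near0 : \forall k \near \oo, c 0%N * (lam `^ s) ^+ k < fine (w i).
  exact: (cvgr_lt _ cvg0 _ w0).
have [k] := filter_ex near0.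
rewrite -ck => lt; have := small k.
by rewrite -(fineK wfin) lte_fin ltNge (ltW lt).
Qed.

End HausdorffLowerBound.

Definition dist_separated (R : realType) (M : metricType R) (T : eqType) (f : T -> M) (r : R) :=
  forall i j, i != j -> r <= mdist (f i) (f j).

(** [expR D ^+ 2] is the loss in [alexandrov_contraction]; 24 is 6 times 4, from the contraction
    ratio [lam ^+ k / 6] and the separation required by [nested_balls_measure]. *)
Definition packing_const (R : realType) (D : R) : R := 24 * expR D ^+ 2.

Lemma ball_volume_gt0 (R : realType) n : 0 < ball_volume R n.
Proof.
have [m] := ubnP n; elim: m n => // m IH [|[|n]] //= nm.
by rewrite mulr_gt0 ?IH// ?divr_gt0 ?mulr_gt0 ?pi_gt0//; exact: ltnW.
Qed.

(** * Packing bounds and nets in Alexandrov spaces *)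

Section Packing.
Context {R : realType} {M : metricType R} (n : nat) (D : R).
Hypothesis n_gt0 : (0 < n)%N.
Hypothesis D_gt0 : 0 < D.
Hypothesis alexM : compact_alexandrov_ge_N1 M.
Hypothesis dimM : hausdorff_dim [set: M] = (n%:R)%:E.
Hypothesis diamM : forall u v : M, mdist u v <= D.

Local Notation A := (packing_const D).

Lemma packing_const_ge : 24 <= A.
Proof. by rewrite /packing_const ler_peMr// exprn_ege1// -expR0 ler_expR ltW. Qed.

(* Contracting a configuration towards the centers of smaller and smaller balls
   produces a self-similar family whose dimension is at most [n]. *)
Lemma packing_bound (T : finType) (f : T -> M) x (l rho : R) :
  0 < l -> 0 < rho -> rho <= 1 -> (forall i, mdist x (f i) <= l) ->
  dist_separated f (rho * l) -> #|T|%:R <= (A / rho) ^+ n.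
Proof.
move=> l0 rho0 rho1 fl fsep; have A24 := packing_const_ge.
have A0 : 0 < A by exact: lt_le_trans A24.
pose lam := rho / A; have lam0 : 0 < lam by exact: divr_gt0.
have lam24 : lam <= 1 / 24 by rewrite ler_pdivrMr//; lra.
have -> : (A / rho) ^+ n = (lam ^+ n)^-1 by rewrite /lam -exprVn invf_div.
rewrite -[leRHS]mul1r ler_pdivlMr ?exprn_gt0// leNgt; apply/negP => big.
set y := #|T|%:R * lam ^+ n in big.
have y0 : 0 < y by exact: lt_trans big.
have lnlam : ln lam < 0 by rewrite ln_lt0// lam0; lra.
(* The similarity dimension of the family: the exponent at which #|T| copies of ratio [lam] balance.
   It exceeds [n] because [y > 1]. *)
pose s' := n%:R + ln y^-1 / ln lam.
have s'n : n%:R < s'.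
  rewrite ltrDl nmulr_rgt0 ?invr_lt0// lnV ?posrE// oppr_lt0.
  exact: ln_gt0.
have Ns' : #|T|%:R * lam `^ s' = 1.
  rewrite /s' powRD; last by rewrite (gt_eqF lam0) implybT.
  rewrite powR_mulrn ?(ltW lam0)// mulrA -/y.
  rewrite /powR gt_eqF// -mulrA mulVf ?lt_eqF// mulr1 lnK ?posrE ?invr_gt0//.
  by rewrite mulfV// gt_eqF.
have : (hausdorff_dim [set: M] < s'%:E)%E by rewrite dimM lte_fin.
move=> /ereal_inf_lt[_ [s [s0 Hs] <-]]; rewrite lte_fin => ss'.
apply: (@nested_balls_measure _ _ T x lam l s _ s0 lam0 _ l0 _ _ Hs).
- by case: alexM.
- by lra.
- rewrite -[X in X <= _]Ns'; apply: ler_wpM2l => //; apply: ger_powR; last exact: ltW.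
  by rewrite lam0; lra.
move=> k z xz.
have /choice[g gg] : forall i, exists g, min_geodesic z (f i) g.
  by move=> i; exact: alexandrov_geo.
(* The points [f i] are within [3 * l] of [z], so this ratio brings them within
   [l * lam ^+ k / 2]. *)
pose t := lam ^+ k / 6.
have lamk0 : 0 < lam ^+ k by rewrite exprn_gt0.
have lamk1 : lam ^+ k <= 1 by rewrite exprn_ile1 ?(ltW lam0)//; lra.
have t01 : 0 <= t <= 1 by rewrite /t; lra.
have zf i : mdist z (f i) <= 3 * l.
  by have := metric_triangle z x (f i); have := fl i; rewrite (metric_sym z x); lra.
exists (fun i => g i (t * mdist z (f i))); split.
  move=> i; rewrite (geo_dist (gg i)).
    have : t * mdist z (f i) <= t * (3 * l) by apply: ler_wpM2l => //; lra.
    by rewrite /t; lra.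
  have := mdist_ge0 z (f i); move: (mdist _ _) => d d0.
  by rewrite mulr_ge0 ?ler_piMl//; lra.
move=> i j ij.
have := alexandrov_contraction alexM diamM (gg i) (gg j) t01.
set dt := mdist (g i _) _; set K2 := expR D ^+ 2 => H.
have K20 : 0 < K2 by rewrite exprn_gt0// expR_gt0.
have AK : A = 24 * K2 by [].
have := le_trans (ler_wpM2l (_ : 0 <= t) (fsep i j ij)) H => /(_ _)/wrap[]; first by lra.
rewrite -ler_pdivrMl// => /(le_trans _); apply.
rewrite ler_pdivlMl// exprS /t.
have -> : K2 * (4 * (l * (lam * lam ^+ k))) = lam ^+ k / 6 * (rho * l) * (lam * A / rho).
  by rewrite AK; field; rewrite gt_eqF.
by rewrite /lam divfK ?gt_eqF// divff ?gt_eqF// mulr1.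
Qed.

(** [packing_bound] limits the size of separated families; one of largest size is a net, since an
    uncovered point could be added. The radius [D + e] keeps the ratio at most 1. *)
Lemma maximal_net (e : R) : 0 < e -> exists N (f : 'I_N -> M),
  dist_separated f e /\ forall x, exists i, mdist x (f i) < e.
Proof.
move=> e0; pose P N := `[< exists f : 'I_N -> M, dist_separated f e >].
have P0 : exists N, P N.
  exists 0%N; apply/asboolP; have f0 : 'I_0 -> M by case=> m; rewrite ltn0.
  by exists f0; case=> m m0; exfalso; rewrite ltn0 in m0.
have De : 0 < D + e by rewrite addr_gt0.
pose B := (A / (e / (D + e))) ^+ n.
have Pbound N : P N -> (N <= Num.truncn B)%N.
  move=> /asboolP[f fe]; case: N f fe => // N f fe.
  have : #|'I_N.+1|%:R <= B.
    apply: (packing_bound (f := f) (x := f ord0) De) => //.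
    - exact: divr_gt0.
    - by rewrite ler_pdivrMr// mul1r lerDr ltW.
    - by move=> i; apply: le_trans (diamM _ _) _; rewrite lerDl ltW.
    - by rewrite divfK ?gt_eqF.
  rewrite card_ord => NB; rewrite truncn_ge_nat//.
  exact: le_trans NB.
case: (ex_maxnP P0 Pbound) => N /asboolP[f fe] maxN; exists N, f; split => // x.
apply: contrapT => no.
have far i : e <= mdist x (f i) by rewrite leNgt; apply/negP => lt; apply: no; exists i.
suff : P N.+1 by move=> /maxN; rewrite ltnn.
apply/asboolP; exists (fun i => if unlift ord0 i is Some j then f j else x).
move=> i j; case: unliftP => [i'|] ->; case: unliftP => [j'|] -> //.
- by move=> ij; apply: fe; apply: contraNneq ij => ->.
- by rewrite metric_sym.
Qed.

(** The [e]-balls around a maximal net have diameter at most [2 * e], so they bound the Hausdorff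
    content at any scale above that. *)
Lemma net_of_measure (v0 : R) : (v0%:E < hausdorff_measure n%:R [set: M])%E ->
  exists2 e0, 0 < e0 & forall e, 0 < e -> e <= e0 ->
  exists N (f : 'I_N -> M), dist_separated f e /\ v0 <= N%:R * (2 * e) ^+ n.
Proof.
move=> /ereal_sup_gt[_ [e1 /= e10 <-] lt]; exists (e1 / 2) => [|e e0 ee1]; first lra.
have [N [f [fe fcov]]] := maximal_net e0; exists N, f; split => //.
rewrite -lee_fin; apply: ltW; apply: lt_le_trans lt _.
have nr0 : (n%:R : R) != 0 by rewrite pnatr_eq0 -lt0n.
pose U i : set M := if insub i is Some j then [set x | mdist x (f j) < e] else set0.
have dU i : (diam (U i) <= (2 * e)%:E)%E.
  rewrite /diam ge_max; apply/andP; split; first by rewrite lee_fin mulr_ge0// ltW.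
  apply: ge_ereal_sup => _ [[x y] /= [Ux Uy] <-]; rewrite lee_fin.
  move: Ux Uy; rewrite /U; case: insub => [j|] //= xj yj.
  by have := metric_triangle x (f j) y; rewrite (metric_sym (f j)); lra.
have d0 : diam (set0 : set M) = 0%E.
  apply/le_anti; rewrite diam_ge0 andbT /diam ge_max; apply/andP; split => //.
  by apply: ge_ereal_sup => u [[x y] [/= F _] _]; case: F.
apply: (@le_trans _ _ (\sum_(0 <= i <oo) poweR (diam (U i)) n%:R)%E).
  apply: ereal_inf_lbound; exists U => //; split => [x _|i].
    have [j xj] := fcov x; exists (j : nat) => //=.
    by rewrite /U insubT// => jN /=; rewrite (_ : Sub _ _ = j)//; exact: val_inj.
  by apply: le_trans (dU i) _; rewrite lee_fin; lra.
rewrite (nneseries_split 0 N)//; last by move=> *; exact: poweR_ge0.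
rewrite [X in (_ + X)%E]eseries0 ?adde0; last first.
  move=> i Ni _.
  have -> : U i = set0.
    by rewrite /U; case: insubP => // j jN; move: Ni; rewrite leqNgt jN.
  by rewrite d0 poweR0r.
apply: (@le_trans _ _ (\sum_(0 <= i < 0 + N) ((2 * e) ^+ n)%:E)%E).
  apply: lee_sum => i _.
  have fin : diam (U i) \is a fin_num.
    by rewrite ge0_fin_numE ?diam_ge0//; apply: le_lt_trans (dU i) (ltry _).
  have := dU i; have := diam_ge0 (U i); rewrite -(fineK fin) poweR_EFin !lee_fin => h0 h1.
  by rewrite powR_mulrn// lerXn2r ?nnegrE//; apply: le_trans h1.
by rewrite add0n sumEFin lee_fin sumr_const_nat subn0 [leRHS]mulr_natl.
Qed.

(** Extends the bound to every scale: a fine net is grouped around the points of a [rho]-net, and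
    [packing_bound] limits each group. *)
Lemma net_lower_bound (v0 rho : R) : (v0%:E < hausdorff_measure n%:R [set: M])%E ->
  0 < rho -> exists N (f : 'I_N -> M), dist_separated f rho /\ v0 <= N%:R * (2 * A * rho) ^+ n.
Proof.
move=> /net_of_measure[e0 e00 H] rho0.
have [N [g [gsep gcov]]] := maximal_net rho0; exists N, g; split => //.
pose e := Num.min e0 rho.
have [ee0 erho] : e <= e0 /\ e <= rho by rewrite /e !ge_min !lexx orbT.
have e_gt0 : 0 < e by rewrite /e lt_min e00.
have [P [f [fsep vP]]] := H e e_gt0 ee0; apply: le_trans vP _.
have /choice[a aP] : forall t, exists i, mdist (f t) (g i) < rho by move=> t; exact: gcov.
have card : P%:R <= N%:R * (A / (e / rho)) ^+ n.
  have -> : P = (\sum_(i : 'I_N) #|{: {t : 'I_P | a t == i}}|)%N.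
    rewrite -[LHS]card_ord -sum1_card (partition_big a xpredT)//=.
    by apply: eq_bigr => i _; rewrite card_sig sum1_card; apply: eq_card.
  rewrite natr_sum.
  apply: (@le_trans _ _ (\sum_(i : 'I_N) (A / (e / rho)) ^+ n)); last first.
    by rewrite sumr_const card_ord mulr_natl.
  apply: ler_sum => i _.
  apply: (packing_bound (f := fun t : {t : 'I_P | a t == i} => f (val t)) (x := g i) rho0).
  - exact: divr_gt0.
  - by rewrite ler_pdivrMr// mul1r.
  - by move=> [t /= /eqP <-]; rewrite metric_sym ltW.
  - by move=> t t' tt'; rewrite divfK ?gt_eqF//; apply: fsep; apply: contraNneq tt' => /val_inj ->.
have e2 : 0 <= (2 * e) ^+ n by rewrite exprn_ge0// mulr_ge0// ltW.
apply: le_trans (ler_wpM2r e2 card) _.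
rewrite -[leLHS]mulrA -exprMn.
have -> // : A / (e / rho) * (2 * e) = 2 * A * rho.
by field; rewrite !gt_eqF.
Qed.

(** The whole space is a ball of radius [d], in which [packing_bound] limits a fine net. *)
Lemma diam_lower_bound (v0 d : R) : 0 < v0 ->
  (v0%:E < hausdorff_measure n%:R [set: M])%E ->
  0 < d -> (forall u v : M, mdist u v <= d) -> v0 <= (2 * A * d) ^+ n.
Proof.
move=> v00 /net_of_measure[e0 e00 H] d0 dM.
pose e := Num.min e0 d.
have [ee0 ed] : e <= e0 /\ e <= d by rewrite /e !ge_min !lexx orbT.
have e_gt0 : 0 < e by rewrite /e lt_min e00.
have [[|P] [f [fsep vP]]] := H e e_gt0 ee0.
  by move: vP; rewrite mul0r leNgt v00.
have : #|'I_P.+1|%:R <= (A / (e / d)) ^+ n.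
  apply: (packing_bound (f := f) (x := f ord0) d0) => //.
  - exact: divr_gt0.
  - by rewrite ler_pdivrMr// mul1r.
  - by rewrite divfK ?gt_eqF.
rewrite card_ord => card; apply: le_trans vP _.
have e2 : 0 <= (2 * e) ^+ n by rewrite exprn_ge0// mulr_ge0// ltW.
apply: le_trans (ler_wpM2r e2 card) _; rewrite -exprMn.
have -> // : A / (e / d) * (2 * e) = 2 * A * d.
by field; rewrite !gt_eqF.
Qed.

End Packing.

(** * The obtuse constant *)

Section ObtuseAngles.
Context {R : realType} {M : metricType R}.
Hypothesis alexM : compact_alexandrov_ge_N1 M.
Implicit Types (p q x y z : M) (g h : R -> M).

Lemma dangle_dir_of p (G H : geodesic_from p) :
  dangle (dir_of G) (dir_of H) = angle p G H.
Proof. by rewrite /dangle /=; apply: norm_cvg_lim; exact: cvg_cst. Qed.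

Lemma angle_itv p x y g h : min_geodesic p x g -> min_geodesic p y h ->
  p != x -> p != y -> 0 <= angle p g h <= pi.
Proof.
move=> gg hh px py; rewrite (angle_acos alexM gg hh px py).
have C1 := cosang_itv alexM gg hh px py.
by rewrite acos_ge0 ?acos_lepi.
Qed.

(** Unfolds the supremum and infimum in [ob_at], which are genuine because angles lie in [0, [pi]].
    Doubling [e] leaves room to pick one geodesic to [q]. *)
Lemma ob_at_angle p q x g (e : R) : p != q -> 0 < Defs.rad M -> 0 < e ->
  ob_at p q <= e -> Defs.rad M / 2 <= mdist p x -> min_geodesic p x g ->
  exists2 h, min_geodesic p q h & angle p g h < pi / 2 + 2 * e.
Proof.
move=> pq rad0 e0 ob px gg.
have far x' : Defs.rad M / 2 <= mdist p x' -> p != x'.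
  by move=> H; rewrite -mdist_gt0; lra.
have [h0 hh0] := alexandrov_geo alexM p q.
pose H0 : geodesic_from p := GeodesicFrom (ex_intro2 _ _ q pq hh0).
pose G : geodesic_from p := GeodesicFrom (ex_intro2 _ _ x (far x px) gg).
have lb x' (G' : geodesic_from p) : p != x' -> min_geodesic p x' G' ->
    lbound [set dangle (dir_of G') a | a in dirs_to p q] 0.
  move=> px' gg' _ [_ [H hh <-] <-]; rewrite dangle_dir_of.
  by have /andP[] := angle_itv gg' hh px' pq.
set S := [set dangle_set (dirs_to p q) xi
      | xi in \bigcup_(x in [set x : M | Defs.rad M / 2 <= mdist p x]) dirs_to p x].
have ubS : has_ubound S.
  exists pi => _ [_ [x' px' [G' gg' <-]] <-].
  have nx' := far _ px'.
  apply: (@le_trans _ _ (dangle (dir_of G') (dir_of H0))).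
    apply: ge_inf; first by exists 0; exact: lb gg'.
    by exists (dir_of H0) => //; exists H0.
  by rewrite dangle_dir_of; have /andP[] := angle_itv gg' hh0 nx' pq.
have : dangle_set (dirs_to p q) (dir_of G) <= sup S.
  by apply: ub_le_sup => //; exists (dir_of G) => //; exists x => //; exists G.
move: ob; rewrite /ob_at -/S => ob le.
have : dangle_set (dirs_to p q) (dir_of G) < pi / 2 + 2 * e by lra.
case/inf_lt; first by exists (dangle (dir_of G) (dir_of H0)), (dir_of H0) => //; exists H0.
move=> _ [_ [H hh <-] <-]; rewrite dangle_dir_of => lt.
by exists H.
Qed.

End ObtuseAngles.

(** * Quantitative estimates for nearly right-angled hyperbolic triangles *)

Section Estimates.
Context {R : realType}.

(* The comparison triangles [(p; q, z)] and [(p; q, z')] are almost right-angled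
   at [p], with [l = |p,q|]; if [z'] is within [om l] of the point [y] dividing
   [[q, z]] in the ratio [sg], then [1 - sg] must be small. In the exact case
   [om = mu = 0] the Stewart inequality reads
   [sinh ((1 - sg) L) cosh(l)^2 <= sinh ((1 - sg) L)]. *)
Lemma right_triangles_ratio (D l L a py pz' qz' sg om mu : R) :
  0 < l -> l <= D -> 0 <= a -> a <= l -> 0 < L -> L <= D -> L <= 3 / 2 * l ->
  0 <= sg -> sg <= 1 -> 0 <= om -> 0 <= mu -> 
  0 <= pz' -> pz' <= l -> 0 <= py -> py <= D -> py <= 3 * l -> 0 <= qz' -> qz' <= D ->
  qz' <= 3 / 2 * l -> py <= pz' + om * l -> qz' <= sg * L + om * l ->
  cosh L <= cosh a * cosh l + sinh a * sinh l * mu ->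
  cosh pz' * cosh l - sinh pz' * sinh l * mu <= cosh qz' ->
  sinh ((1 - sg) * L) * cosh l + sinh (sg * L) * cosh a <= sinh L * cosh py ->
  1 - sg <= expR D ^+ 3 * (4 * om + 2 * mu).
Proof.
move=> l0 lD a0 al L0 LD L3 sg0 sg1 om0 mu0 pz0 pzl py0 pyD py3 qz0 qzD qz3 pyz qzs up lo st.
set K := expR D; have K1 : 1 <= K by rewrite -expR0 ler_expR; lra.
have K0 : 0 < K by lra.
have sinhK u : 0 <= u -> u <= D -> sinh u <= u * K.
  move=> u0 uD; apply: le_trans (sinh_le u0) _.
  by rewrite ler_wpM2l// ler_expR.
have coshK u : 0 <= u -> u <= D -> cosh u <= K.
  by move=> u0 uD; apply: le_trans (cosh_le_exp u0) _; rewrite ler_expR.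
have l2 : 0 <= l ^+ 2 by exact: sqr_ge0.
have coshlip x y : 0 <= x -> 0 <= y -> y <= D -> y <= x + om * l -> x + y <= 4 * l ->
    cosh y <= cosh x + K * (2 * om * l ^+ 2).
  move=> x0 y0 yD yx xy; clear -K0 l0 l2 om0 x0 y0 yD yx xy.
  have ol : 0 <= K * (2 * om * l ^+ 2) by rewrite !mulr_ge0// ltW.
  case: (leP y x) => [yx'|xy']; first by have := ler_cosh y0 x0; rewrite yx' => h; lra.
  have := coshB_le x0 (ltW xy').
  have : expR y * ((y ^+ 2 - x ^+ 2) / 2) <= K * (2 * om * l ^+ 2).
    apply: ler_pM; rewrite ?expR_ge0 ?ler_expR//.
      by rewrite divr_ge0// subr_sqr mulr_ge0//; lra.
    have -> : (y ^+ 2 - x ^+ 2) / 2 = (y - x) * ((x + y) / 2) by field.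
    have -> : 2 * om * l ^+ 2 = (om * l) * (2 * l) by ring.
    by apply: ler_pM; lra.
  by lra.
set Ch := cosh l in up lo st; have Ch1 : 1 <= Ch by exact: cosh_ge1.
have Ch0 : 0 <= Ch by exact: le_trans Ch1.
have ChK : Ch <= K by apply: coshK => //; exact: ltW.
set E := K ^+ 2 * l ^+ 2 * mu.
have E0 : 0 <= E by apply: mulr_ge0 => //; exact: mulr_ge0 (sqr_ge0 _) l2.
have err u : 0 <= u -> u <= l -> sinh u * sinh l * mu <= E.
  move=> u0 ul; rewrite /E ler_wpM2r//.
  have -> : K ^+ 2 * l ^+ 2 = (l * K) * (l * K) by ring.
  apply: ler_pM; rewrite ?sinh_ge0 ?(ltW l0)//; last by apply: sinhK => //; exact: ltW.
  apply: le_trans (sinhK u u0 (le_trans ul lD)) _.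
  by rewrite ler_wpM2r// ltW.
have Eu := err a a0 al; have Ep := err pz' pz0 pzl.
set W := K * (2 * om * l ^+ 2).
have W0 : 0 <= W by rewrite !mulr_ge0// ltW.
have sgL0 : 0 <= sg * L by rewrite mulr_ge0// ltW.
have sgLL : sg * L <= L by rewrite ler_piMl// ltW.
have c1 : cosh py <= cosh pz' + W.
  by apply: coshlip => //; clear -pzl py3; lra.
have c2 : cosh qz' <= cosh (sg * L) + W.
  by apply: coshlip => //; clear -l0 sgLL L3 qz3; lra.
have c3 : cosh py * Ch <= cosh (sg * L) + W + E + K * W.
  have : cosh py * Ch <= (cosh pz' + W) * Ch by rewrite ler_wpM2r.
  have : W * Ch <= K * W by rewrite mulrC ler_wpM2r.
  by clear -c2 lo Ep; lra.
have sL0 : 0 < sinh L by exact: sinh_gt0.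
have c4 := ler_wpM2l (ltW sL0) c3.
have c5 := ler_wpM2l Ch0 st.
have ssg0 : 0 <= sinh (sg * L) by exact: sinh_ge0.
have c6 : sinh (sg * L) * cosh L <= sinh (sg * L) * (cosh a * Ch + E).
  by apply: ler_wpM2l => //; clear -up Eu; lra.
have ssgL : sinh (sg * L) * E <= sinh L * E by rewrite ler_wpM2r// ler_sinh.
(* Multiplying the Stewart inequality by [cosh l] makes this very difference appear on the right, so
   only the factor [Ch ^+ 2 - 1] survives against the error terms. *)
have dec : sinh ((1 - sg) * L) = sinh L * cosh (sg * L) - cosh L * sinh (sg * L).
  by rewrite -sinhB; congr sinh; ring.
have c7 : sinh ((1 - sg) * L) * (Ch ^+ 2 - 1) <= sinh L * (W + K * W + 2 * E).
  by rewrite expr2; clear -c4 c5 c6 ssgL dec; lra.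
have Chl : l ^+ 2 <= Ch ^+ 2 - 1.
  by rewrite /Ch cosh_sqr addrC addKr lerXn2r ?nnegrE ?sinh_ge0 ?sinh_ge ?(ltW l0).
have c8 : (1 - sg) * L * l ^+ 2 <= sinh ((1 - sg) * L) * (Ch ^+ 2 - 1).
  have sgL1 : 0 <= (1 - sg) * L by apply: mulr_ge0; [rewrite subr_ge0|exact: ltW].
  by apply: ler_pM => //; exact: sinh_ge.
have c9 : sinh L * (W + K * W + 2 * E) <= L * K * (2 * (K * W) + 2 * E).
  apply: ler_pM; rewrite ?(ltW sL0)//.
  - by apply: addr_ge0; [apply: addr_ge0 => //; exact: mulr_ge0 (ltW K0) W0|exact: mulr_ge0].
  - by apply: sinhK => //; exact: ltW.
  - by rewrite lerD2r mulr_natl mulr2n lerD2r ler_peMl.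
have l20 : 0 < L * l ^+ 2 by rewrite mulr_gt0// exprn_gt0.
rewrite -(ler_pM2r l20).
have -> : K ^+ 3 * (4 * om + 2 * mu) * (L * l ^+ 2) = L * K * (2 * (K * W) + 2 * E).
  by rewrite /W /E; ring.
by clear -c7 c8 c9; lra.
Qed.

(* The hypothesis bounds the angle at the vertex opposite to [X] from above, the
   conclusion bounds the other angle adjacent to the short side [l] from below. *)
Lemma almost_right_angle (D R0 l X Y c : R) :
  0 < l -> l <= D -> 0 < R0 -> R0 <= X -> X <= D -> 0 <= Y -> Y <= D -> 0 <= c ->
  cosh X <= cosh Y * cosh l + sinh Y * sinh l * c ->
  hyp_cos X l Y <= expR D * (expR D * l + c) / R0.
Proof.
move=> l0 lD R00 R0X XD Y0 YD c0 H.
set K := expR D; have K1 : 1 <= K by rewrite -expR0 ler_expR; lra.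
have X0 : 0 < X by lra.
have sX := sinh_gt0 X0; have sl := sinh_gt0 l0; have sXR : R0 <= sinh X.
  by apply: le_trans (sinh_ge _); lra.
have sY : sinh Y <= K by apply: le_trans (sinh_le_exp _) _; rewrite ler_expR.
have cX : cosh X <= K by apply: le_trans (cosh_le_exp _) _; rewrite ?ler_expR; lra.
have slK : sinh l <= K * l.
  by apply: le_trans (sinh_le (ltW l0)) _; rewrite mulrC ler_wpM2r ?ler_expR; lra.
have cl := cosh_ge1 l.
have N0 : 0 <= K * (K * l + c).
  by apply: mulr_ge0; [lra|apply: addr_ge0 => //; apply: mulr_ge0; lra].
have num : cosh X * cosh l - cosh Y <= K * (K * l + c) * sinh l.
  have cl0 : 0 < cosh l by lra.
  have h1 : sinh Y * sinh l * c <= K * sinh l * c.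
    by rewrite ler_wpM2r// ler_wpM2r// ltW.
  have h2 : cosh X * (sinh l * sinh l) <= K * (K * l) * sinh l.
    have : cosh X * sinh l <= K * (K * l).
      by apply: ler_pM => //; [exact/ltW/cosh_gt0|exact: ltW].
    by move/(ler_wpM2r (ltW sl)); lra.
  have h3 : (cosh X * cosh l - cosh Y) * cosh l <= K * (K * l + c) * sinh l.
    have : cosh X * (cosh l * cosh l) = cosh X * (1 + sinh l * sinh l).
      by rewrite -!expr2 cosh_sqr.
    by lra.
  case: (leP 0 (cosh X * cosh l - cosh Y)) => sg.
    by apply: le_trans h3; rewrite ler_peMr.
  apply: ltW; apply: lt_le_trans sg _.
  exact: mulr_ge0 N0 (ltW sl).
rewrite /hyp_cos ler_pdivrMr; last exact: mulr_gt0.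
apply: le_trans num _.
have -> : K * (K * l + c) / R0 * (sinh X * sinh l) = K * (K * l + c) * sinh l * (sinh X / R0).
  by field; rewrite gt_eqF.
by apply: ler_peMr; [exact: mulr_ge0 N0 (ltW sl)|rewrite ler_pdivlMr// mul1r].
Qed.

End Estimates.

(** * Nearly right comparison angles from small obtuse constants *)

Section NearlyRightAngles.
Context {R : realType} {M : metricType R} (D R0 eps c mu : R).
Hypothesis alexM : compact_alexandrov_ge_N1 M.
Hypothesis diamM : forall u v : M, mdist u v <= D.
Hypothesis R0_gt0 : 0 < R0.
Hypothesis R0_le : R0 <= Defs.rad M.
Hypothesis eps_gt0 : 0 < eps.
Hypothesis c_ge0 : 0 <= c.
Hypothesis c_le1 : c <= 1.
Hypothesis c_eps : acos (- c) = pi / 2 + 2 * eps.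
Hypothesis c_mu : c <= mu.
Implicit Types (p q x y z : M) (g h : R -> M).

Let rad_gt0 : 0 < Defs.rad M. Proof. exact: lt_le_trans R0_le. Qed.

Lemma ob_at_cosang p q x g : p != q -> ob_at p q <= eps ->
  Defs.rad M / 2 <= mdist p x -> min_geodesic p x g ->
  exists2 h, min_geodesic p q h & - c < cosang g h.
Proof.
move=> pq ob px gg.
have [h hh] := ob_at_angle alexM pq rad_gt0 eps_gt0 ob px gg.
have npx : p != x by rewrite -mdist_gt0; have := rad_gt0; lra.
have C1 := cosang_itv alexM gg hh npx pq.
have c1 : -1 <= - c <= 1 by have := c_ge0; have := c_le1; lra.
by rewrite (angle_acos alexM gg hh npx pq) -c_eps acos_anti//; exists h.
Qed.

Lemma ob_at_hinge p q x g a : p != q -> ob_at p q <= eps ->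
  Defs.rad M / 2 <= mdist p x -> min_geodesic p x g -> 0 < a -> a <= mdist p x ->
  cosh (mdist q (g a)) <= cosh a * cosh (mdist p q) + sinh a * sinh (mdist p q) * c.
Proof.
move=> pq ob px gg a0 apx; have [h hh hc] := ob_at_cosang pq ob px gg.
have ax : 0 <= a <= mdist p x by rewrite apx ltW.
have pa := geo_dist gg ax.
have npa : p != g a by rewrite -mdist_gt0 pa.
have := alexandrov_hinge alexM (geo_head gg ax) hh npa pq.
rewrite /hinge pa metric_sym => /le_trans; apply.
have ss : 0 <= sinh a * sinh (mdist p q).
  by rewrite mulr_ge0// sinh_ge0 ?mdist_ge0// ltW.
by have := ler_wpM2l ss (ltW hc); lra.
Qed.

(** The upper bound is the hinge at [p]. The hinge at [q] towards [x] keeps the comparison angle at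
    [p] from being much below [pi / 2], and monotonicity passes this from [x] to [g a]. *)
Lemma nearly_right_angle p q x g a : p != q -> ob_at p q <= eps -> ob_at q p <= eps ->
  Defs.rad M / 2 <= mdist p x -> Defs.rad M / 2 <= mdist q x ->
  expR D * (expR D * mdist p q + c) / (R0 / 2) <= mu ->
  min_geodesic p x g -> 0 < a -> a <= mdist p x ->
  cosh (mdist q (g a)) <= cosh a * cosh (mdist p q) + sinh a * sinh (mdist p q) * mu /\
  cosh a * cosh (mdist p q) - sinh a * sinh (mdist p q) * mu <= cosh (mdist q (g a)).
Proof.
move=> pq obpq obqp px qx le_mu gg a0 apx.
have l0 : 0 < mdist p q by rewrite mdist_gt0.
have ss : 0 <= sinh a * sinh (mdist p q).
  by rewrite mulr_ge0// sinh_ge0 ?mdist_ge0// ltW.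
split.
  apply: le_trans (ob_at_hinge pq obpq px gg a0 apx) _.
  by rewrite lerD2l ler_wpM2l.
have [g' gg'] := alexandrov_geo alexM q x.
have qp : q != p by rewrite eq_sym.
have qx0 : 0 < mdist q x by apply: lt_le_trans qx; have := rad_gt0; lra.
have px0 : 0 < mdist p x by apply: lt_le_trans px; have := rad_gt0; lra.
have := ob_at_hinge qp obqp qx gg' qx0 (lexx _).
case: (gg') => _ -> _; rewrite (metric_sym q p) => H.
have R02 : 0 < R0 / 2 by have := R0_gt0; lra.
have R0x : R0 / 2 <= mdist p x by apply: le_trans px; have := R0_le; lra.
have := almost_right_angle l0 (diamM p q) R02 R0x (diamM p x) (mdist_ge0 q x) (diamM q x) c_ge0 H.
move=> /le_trans/(_ le_mu) H'.
have ax : 0 <= a <= mdist p x by rewrite apx ltW.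
have pa := geo_dist gg ax; have ax' := geo_dist_end gg ax.
rewrite mulrC (mulrC (sinh a)) -hyp_cos_le//; apply: le_trans H'.
have paxE : a + (mdist p x - a) = mdist p x by rewrite addrC subrK.
rewrite (hyp_cosC (mdist p x)) -[in X in _ <= hyp_cos _ X _]paxE.
apply: stewart_monotone => //; first by rewrite subr_ge0.
have := @alexandrov_stewart _ _ alexM p x (g a) q.
by rewrite /stewart pa ax' paxE (metric_sym q p); apply.
Qed.

End NearlyRightAngles.

(** * Counting separated points near a close pair *)

Section Counting.
Context {R : realType} {M : metricType R} (n N : nat) (D R0 v0 eps c delta : R).
Hypothesis n_gt0 : (0 < n)%N.
Hypothesis N_gt0 : (0 < N)%N.
Hypothesis D_gt0 : 0 < D.
Hypothesis alexM : compact_alexandrov_ge_N1 M.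
Hypothesis dimM : hausdorff_dim [set: M] = (n%:R)%:E.
Hypothesis diamM : forall u v : M, mdist u v <= D.
Hypothesis volM : (v0%:E < hausdorff_measure n%:R [set: M])%E.
Hypothesis R0_gt0 : 0 < R0.
Hypothesis R0_leD : R0 <= D.
Hypothesis R0_le : R0 <= Defs.rad M.
Let K := expR D.
Let A := packing_const D.
(* A net of scale [Gamma * kappa] in [M] becomes [kappa * l]-separated after the
   three contractions (into the far region, towards [p], towards [q]). *)
Let Gamma := 32 * D ^+ 2 * K ^+ 6 / R0.
(* [kappa] and the angle error [mu] are small enough for
   [right_triangles_ratio] to tell apart the ratios [1 - k / (2 N)]. *)
Let kappa := (64 * K ^+ 5 * N%:R)^-1.
Let mu := (16 * K ^+ 3 * N%:R)^-1.
Hypothesis N_big : (4 * A ^+ 2 * Gamma) ^+ n < N%:R * v0.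
Hypothesis eps_gt0 : 0 < eps.
Hypothesis c_ge0 : 0 <= c.
Hypothesis c_le1 : c <= 1.
Hypothesis c_eps : acos (- c) = pi / 2 + 2 * eps.
Hypothesis c_mu : c <= mu.
Hypothesis delta_R0 : delta <= R0 / 8.
Hypothesis delta_mu : K * (K * delta + c) / (R0 / 2) <= mu.

Let K1 : 1 <= K. Proof. by rewrite /K -expR0 ler_expR ltW. Qed.
Let K0 : 0 < K. Proof. exact: expR_gt0. Qed.
Let Nr0 : 0 < N%:R :> R. Proof. by rewrite ltr0n. Qed.
Let kappa_gt0 : 0 < kappa.
Proof. by rewrite invr_gt0 !mulr_gt0// exprn_gt0. Qed.
Let mu_gt0 : 0 < mu.
Proof. by rewrite invr_gt0 !mulr_gt0// exprn_gt0. Qed.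
Let Gamma_gt0 : 0 < Gamma.
Proof. by rewrite /Gamma divr_gt0// !mulr_gt0// exprn_gt0. Qed.
Let Nr1 : 1 <= N%:R :> R. Proof. by rewrite ler1n. Qed.
Let kappa_le1 : kappa <= 1.
Proof.
rewrite invf_le1 ?mulr_gt0 ?exprn_gt0//.
by rewrite mulr_ege1// mulr_ege1 ?exprn_ege1//; lra.
Qed.

Lemma rad_far_point (p : M) : exists y, 7 / 8 * Defs.rad M < mdist p y.
Proof.
have rad0 : 0 < Defs.rad M by exact: lt_le_trans R0_le.
have radp : Defs.rad M <= sup [set mdist p q | q in [set: M]].
  apply: ge_inf; last by exists p.
  exists 0 => _ [p' _ <-]; apply: (@le_trans _ _ (mdist p' p)); first exact: mdist_ge0.
  by apply: ub_le_sup; [exists D => _ [q _ <-]|exists p].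
have : 7 / 8 * Defs.rad M < sup [set mdist p q | q in [set: M]] by lra.
by case/sup_gt => [|_ [y _ <-] ?]; [exists (mdist p p), p|exists y].
Qed.

(** Contract a net of [M] towards a point [y] nearly at maximal distance from [p], with ratio
    [R0 / (8 * D)]: the image stays within [R0 / 8] of [y], hence far from both [p] and [q]. *)
Lemma far_net (p q : M) : mdist p q < delta ->
  exists P (x : 'I_P -> M), [/\ dist_separated x (4 * D * K ^+ 4 * kappa),
    forall i, Defs.rad M / 2 <= mdist p (x i) /\ Defs.rad M / 2 <= mdist q (x i) &
    v0 <= P%:R * (2 * A * (Gamma * kappa)) ^+ n].
Proof.
move=> pq; have rad0 : 0 < Defs.rad M by exact: lt_le_trans R0_le.
have [y py] := rad_far_point p.
have Gk0 : 0 < Gamma * kappa.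
  exact: mulr_gt0.
have [P [f [fsep vP]]] := net_lower_bound n_gt0 D_gt0 alexM dimM diamM volM Gk0.
have /choice[g gg] : forall i, exists g, min_geodesic y (f i) g.
  by move=> i; exact: alexandrov_geo.
pose t := R0 / (8 * D).
have t0 : 0 < t by rewrite divr_gt0// mulr_gt0.
have t1 : t <= 1.
  have D8 : 0 < 8 * D by rewrite mulr_gt0.
  by rewrite ler_pdivrMr//; have := R0_leD; have := D_gt0; lra.
have t01 : 0 <= t <= 1 by rewrite ltW.
exists P, (fun i => g i (t * mdist y (f i))); split=> //.
- move=> i j ij; have := alexandrov_contraction alexM diamM (gg i) (gg j) t01.
  have := ler_wpM2l (ltW t0) (fsep i j ij).
  set d := mdist (g i _) _ => h1 h2; have {h1 h2} := le_trans h1 h2.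
  rewrite -/K -ler_pdivrMl ?exprn_gt0// => /(le_trans _); apply.
  rewrite ler_pdivlMl ?exprn_gt0// le_eqVlt; apply/orP; left; apply/eqP.
  by rewrite /t /Gamma; field; rewrite !gt_eqF.
- move=> i; have yx : mdist y (g i (t * mdist y (f i))) <= R0 / 8.
    rewrite (geo_dist (gg i)); last first.
      by rewrite mulr_ge0 ?mdist_ge0 ?(ltW t0)//= ler_piMl// mdist_ge0.
    apply: (@le_trans _ _ (t * D)); first by rewrite ler_pM2l.
    by rewrite /t invfM mulrA mulfVK// gt_eqF.
  move: yx; set x := g i _ => yx.
  have := metric_triangle p x y; have := metric_triangle p q x.
  by rewrite (metric_sym x y); have := R0_le; have := delta_R0; split; lra.
Qed.

Lemma ob_pair_gt (p q : M) : p != q -> mdist p q < delta -> eps < ob_pair p q.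
Proof.
move=> pq pqd; rewrite ltNge; apply/negP; rewrite /ob_pair ge_max => /andP[obpq obqp].
set l := mdist p q in pqd.
have l0 : 0 < l by rewrite mdist_gt0.
have [l2l l3l] : l / 2 <= l /\ l + 3 / 2 * l <= 3 * l by lra.
have rad0 : 0 < Defs.rad M by exact: lt_le_trans R0_le.
have [P [x [xsep xfar vP]]] := far_net pqd.
have le_mu : K * (K * l + c) / (R0 / 2) <= mu.
  apply: le_trans delta_mu; rewrite ler_pM2r ?invr_gt0; last by have := R0_gt0; lra.
  by rewrite ler_pM2l// lerD2r ler_pM2l// ltW.
have /choice[g gg] : forall i, exists g, min_geodesic p (x i) g.
  by move=> i; exact: alexandrov_geo.
(* This ratio puts the images [z i] within [l / 2] of [p], so their distance to [q] is between
   [l / 2] and [3 / 2 * l]. *)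
pose t := l / (2 * D).
have t0 : 0 < t by rewrite divr_gt0// mulr_gt0.
have lD : l <= D by exact: diamM.
have t1 : t <= 1.
  have D2 : 0 < 2 * D by rewrite mulr_gt0.
  by rewrite ler_pdivrMr//; have := D_gt0; lra.
have t01 : 0 <= t <= 1 by rewrite ltW.
pose a i := t * mdist p (x i); pose z i := g i (a i).
have px0 i : 0 < mdist p (x i) by have [? _] := xfar i; lra.
have a0 i : 0 < a i by rewrite mulr_gt0.
have ax i : a i <= mdist p (x i) by rewrite ler_piMl// ltW.
have al i : a i <= l / 2.
  apply: (@le_trans _ _ (t * D)); first by rewrite ler_pM2l.
  by rewrite /t invfM mulrA mulfVK// gt_eqF.
have pz i : mdist p (z i) = a i by apply: (geo_dist (gg i)); rewrite ax ltW.
have right i : cosh (mdist q (z i)) <= cosh (a i) * cosh l + sinh (a i) * sinh l * mu /\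
    cosh (a i) * cosh l - sinh (a i) * sinh l * mu <= cosh (mdist q (z i)).
  have [px qx] := xfar i.
  exact: (nearly_right_angle alexM diamM R0_gt0 R0_le eps_gt0 c_ge0 c_le1 c_eps c_mu
    pq obpq obqp px qx le_mu (gg i) (a0 i) (ax i)).
pose L i := mdist q (z i).
have [Llo Lup] : (forall i, l / 2 <= L i) /\ (forall i, L i <= 3 / 2 * l).
  split=> i; have := metric_triangle p (z i) q; have := metric_triangle q p (z i);
    rewrite /L pz (metric_sym q p) (metric_sym (z i) q) -/l; have := al i; lra.
have L0 i : 0 < L i by apply: lt_le_trans (Llo i); lra.
have /choice[G GG] : forall i, exists G, min_geodesic q (z i) G.
  by move=> i; exact: alexandrov_geo.
(* [N] ratios in [1/2, 1], spaced by [1 / (2 * N)]. *)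
pose s (k : 'I_N) : R := 1 - k%:R / (2 * N%:R).
have s_itv k : 1 / 2 <= s k <= 1.
  have kN : (k : nat)%:R <= N%:R :> R by rewrite ler_nat ltnW.
  have : (k : nat)%:R / (2 * N%:R) <= 1 / 2 :> R by rewrite ler_pdivrMr ?mulr_gt0//; lra.
  have : 0 <= (k : nat)%:R / (2 * N%:R) :> R by rewrite divr_ge0// mulr_ge0.
  by rewrite /s; lra.
have s_gap (k k' : 'I_N) : (k' < k)%N -> s k <= s k' - (2 * N%:R)^-1.
  move=> kk; rewrite /s -addrA lerD2l -opprD lerN2 -{2}[_^-1]mul1r -mulrDl.
  by rewrite ler_pM2r ?invr_gt0 ?mulr_gt0// natr1 ler_nat.
pose w (ki : 'I_N * 'I_P) := G ki.2 (s ki.1 * L ki.2).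
have qw ki : mdist q (w ki) = s ki.1 * L ki.2.
  apply: (geo_dist (GG _)); rewrite -/(L _); have := s_itv ki.1; have := L0 ki.2.
  by move=> L0' /andP[s1 s2]; rewrite mulr_ge0 ?ler_piMl ?(ltW L0')//=; lra.
have same_level k i j : i != j -> kappa * l <= mdist (w (k, i)) (w (k, j)).
  move=> ij; have /andP[s1 s2] := s_itv k.
  have s01 : 0 <= s k <= 1 by lra.
  have h1 := alexandrov_contraction alexM diamM (GG i) (GG j) s01.
  have h2 := alexandrov_contraction alexM diamM (gg i) (gg j) t01.
  rewrite -/K -/(L i) -/(L j) -/(w (k, i)) -/(w (k, j)) in h1.
  rewrite -/K -/(a i) -/(a j) -/(z i) -/(z j) in h2.
  have h3 : t * (4 * D * K ^+ 4 * kappa) <= K ^+ 2 * mdist (z i) (z j).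
    by apply: le_trans h2; rewrite ler_pM2l// xsep.
  have h4 : 1 / 2 * mdist (z i) (z j) <= K ^+ 2 * mdist (w (k, i)) (w (k, j)).
    by apply: le_trans h1; rewrite ler_wpM2r ?mdist_ge0.
  have K20 : 0 < K ^+ 2 by rewrite exprn_gt0.
  have h5 := ler_wpM2l (ltW K20) h4.
  have K40 : 0 < K ^+ 4 by rewrite exprn_gt0.
  rewrite -(ler_pM2l K40).
  have e1 : t * (4 * D * K ^+ 4 * kappa) = 2 * (K ^+ 4 * (kappa * l)).
    by rewrite /t; field; rewrite gt_eqF.
  have e2 : K ^+ 4 = K ^+ 2 * K ^+ 2 by rewrite -exprD.
  by move: h3; rewrite e1 e2 => h3; lra.
(* The contraction from [q] of ratio [s k'] takes the point [y] of [G i] at ratio [s k / s k'] to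
   [w (k, i)], and [z j] to [w (k', j)]. If the images are close, so are [y] and [z j], and
   [right_triangles_ratio] forces the two levels too near each other. *)
have diff_level (k k' : 'I_N) i j : (k' < k)%N -> kappa * l <= mdist (w (k, i)) (w (k', j)).
  move=> kk; rewrite leNgt; apply/negP => close.
  have /andP[s1 s2] := s_itv k; have /andP[s1' s2'] := s_itv k'.
  have gap := s_gap _ _ kk.
  have N2 : 0 < (2 * N%:R)^-1 :> R by rewrite invr_gt0 mulr_gt0.
  pose sg := s k / s k'.
  have s'0 : 0 < s k' by apply: lt_le_trans s1'; rewrite divr_gt0.
  have sg0 : 0 <= sg by apply: divr_ge0; [apply: (le_trans _ s1); exact: divr_ge0|exact: ltW].
  have sg1 : sg <= 1 - (2 * N%:R)^-1.
    rewrite ler_pdivrMr//.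
    have : (2 * N%:R)^-1 * s k' <= (2 * N%:R)^-1 by rewrite ler_piMr// ltW.
    by lra.
  have sg1' : sg <= 1 by apply: le_trans sg1 _; rewrite gerBl ltW.
  pose y := G i (sg * L i).
  have sgL : 0 <= sg * L i <= mdist q (z i).
    by rewrite mulr_ge0 ?(ltW (L0 i))//= ler_piMl// ltW.
  have qy : mdist q y = sg * L i := geo_dist (GG i) sgL.
  have yz : mdist y (z i) = L i - sg * L i := geo_dist_end (GG i) sgL.
  have s01 : 0 <= s k' <= 1 by rewrite ltW.
  have := alexandrov_contraction alexM diamM (geo_head (GG i) sgL) (GG j) s01.
  rewrite -/K -/y qy -/(L j) mulrA [s k' * sg]mulrC /sg mulfVK ?gt_eqF//.
  rewrite -/sg -/(w (k, i)) -/(w (k', j)) => h1.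
  have K20 : 0 < K ^+ 2 by rewrite exprn_gt0.
  pose om := 2 * K ^+ 2 * kappa.
  have om0 : 0 <= om by rewrite !mulr_ge0// ltW.
  have yz' : mdist y (z j) <= om * l.
    have h2 : 2^-1 * mdist y (z j) <= s k' * mdist y (z j).
      by rewrite ler_wpM2r ?mdist_ge0// -div1r.
    have h3 : K ^+ 2 * mdist (w (k, i)) (w (k', j)) <= K ^+ 2 * (kappa * l).
      by rewrite ler_pM2l// ltW.
    have -> : om * l = 2 * (K ^+ 2 * (kappa * l)) by rewrite /om; ring.
    by rewrite -ler_pdivrMl//; exact: le_trans h2 (le_trans h1 h3).
  have st : sinh ((1 - sg) * L i) * cosh l + sinh (sg * L i) * cosh (a i) <=
      sinh (L i) * cosh (mdist p y).
    have := @alexandrov_stewart _ _ alexM q (z i) y p.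
    rewrite /stewart qy yz -/(L i) -/l pz mulrBl mul1r; apply.
    by rewrite addrC subrK.
  have [up _] := right i; have [_ lo] := right j.
  have tri1 := metric_triangle p (z j) y; have tri2 := metric_triangle q y (z j).
  have tri3 := metric_triangle p q y.
  have sgLL : sg * L i <= L i by rewrite ler_piMl// ltW.
  have := @right_triangles_ratio _ D l (L i) (a i) (mdist p y) (a j) (L j) sg om mu
    l0 lD (ltW (a0 i)) _ (L0 i) (diamM _ _) (Lup i) sg0 sg1' om0 (ltW mu_gt0)
    (ltW (a0 j)) _ (mdist_ge0 _ _) (diamM _ _) _ (ltW (L0 j)) (diamM _ _) (Lup j) _ _ up lo st.
  (* [kappa] and [mu] each contribute [1 / (8 * N)]; the sum is half the gap between levels. *)
  rewrite -/K; have -> : K ^+ 3 * (4 * om + 2 * mu) = (4 * N%:R)^-1.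
    rewrite /om /kappa /mu; field.
    by rewrite !gt_eqF.
  have half : (4 * N%:R)^-1 = (2 * N%:R)^-1 / 2 :> R by field; rewrite gt_eqF.
  rewrite half => H.
  have gap1 : (2 * N%:R)^-1 <= 1 - sg by rewrite lerBrDr addrC -lerBrDr.
  suff : 1 - sg <= (2 * N%:R)^-1 / 2 by move/(le_trans gap1); rewrite leNgt ltr_pdivrMr// ltr_pMr// ltr1n.
  apply: H.
  - exact: le_trans (al i) l2l.
  - exact: le_trans (al j) l2l.
  - rewrite qy in tri3; apply: le_trans tri3 (le_trans _ l3l).
    by rewrite lerD2l; exact: le_trans sgLL (Lup i).
  - by rewrite -(pz j); apply: le_trans tri1 _; rewrite lerD2l metric_sym.
  - by rewrite -qy; apply: le_trans tri2 _; rewrite lerD2l.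
have wsep : dist_separated w (kappa / 2 * (2 * l)).
  move=> [k i] [k' j]; have -> : kappa / 2 * (2 * l) = kappa * l by field.
  case: (ltngtP k k') => [kk|kk|/val_inj ->] ne.
  - by rewrite metric_sym; exact: diff_level.
  - exact: diff_level.
  - by apply: same_level; apply: contraNneq ne => ->.
have l20 : 0 < 2 * l by lra.
have k20 : 0 < kappa / 2 by have := kappa_gt0; lra.
have k21 : kappa / 2 <= 1 by have := kappa_le1; have := kappa_gt0; lra.
have wl ki : mdist q (w ki) <= 2 * l.
  rewrite qw; have /andP[s1 s2] := s_itv ki.1.
  apply: (@le_trans _ _ (L ki.2)); first by rewrite ler_piMl// ltW.
  by have := Lup ki.2; lra.
(* This bounds [N * P] by [(2 * A / kappa) ^+ n]. Against the lower bound on [P] from [far_net],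
   [kappa] cancels and [N_big] is contradicted. *)
have := packing_bound D_gt0 alexM dimM diamM l20 k20 k21 wl wsep.
rewrite card_prod !card_ord natrM -/A => card.
move: N_big; apply/negP; rewrite -leNgt.
have AG0 : 0 <= (2 * A * (Gamma * kappa)) ^+ n.
  apply: exprn_ge0; apply: mulr_ge0; last by apply: mulr_ge0; exact: ltW.
  by apply: mulr_ge0 => //; apply: mulr_ge0 => //; exact: sqr_ge0.
apply: le_trans (ler_wpM2l (ltW Nr0) vP) _.
rewrite [leLHS]mulrA; apply: le_trans (ler_wpM2r AG0 card) _.
rewrite -exprMn; have -> // : A / (kappa / 2) * (2 * A * (Gamma * kappa)) = 4 * A ^+ 2 * Gamma.
by field; rewrite gt_eqF.
Qed.

End Counting.

(** * Choice of the constants and conclusion *)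

Lemma alexandrov_family_measure (R : realType) (M : metricType R) n (v : R) :
  0 < v -> (v%:E <= volume M n)%E ->
  ((v / (ball_volume R n / 2 ^+ n) / 2)%:E < hausdorff_measure n%:R [set: M])%E.
Proof.
move=> v0 vol; set b := ball_volume R n / 2 ^+ n.
have b0 : 0 < b by rewrite divr_gt0 ?ball_volume_gt0// exprn_gt0.
rewrite ltNge; apply/negP => le.
have := le_trans vol (lee_wpmul2l (_ : (0 <= b%:E)%E) le); rewrite lee_fin => /(_ (ltW b0)).
rewrite -EFinM lee_fin mulrA mulrCA mulfV ?gt_eqF// mulr1.
by lra.
Qed.

Theorem theorem1p1 (R : realType) (n : nat) (D v : R) :
  (0 < n)%N -> 0 < D -> 0 < v ->
  exists2 eps : R, 0 < eps &
    (forall M : metricType R, alexandrov_family n D v M -> (eps%:E < ob M)%E) /\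
    (exists2 delta : R, 0 < delta &
      forall M : metricType R, alexandrov_family n D v M ->
      forall p q : M, p != q -> mdist p q < delta -> eps < ob_pair p q).
Proof.
move=> n0 D0 v_gt0.
(* One uniform bound for close pairs suffices; halving [eps] makes the inequality for the lower
   limit strict. *)
suff [eps [delta [eps0 delta0 H]]] : exists eps delta : R, [/\ 0 < eps, 0 < delta &
    forall M : metricType R, alexandrov_family n D v M ->
    forall p q : M, p != q -> mdist p q < delta -> eps < ob_pair p q].
  have eps2 : 0 < eps / 2 by rewrite divr_gt0.
  have lt2 : eps / 2 < eps by rewrite ltr_pdivrMr//; lra.
  exists (eps / 2) => //; split => [M fam|].
    apply: (@lt_le_trans _ _ eps%:E); first by rewrite lte_fin.
    pose V := [set pq : M * M | pq.1 != pq.2 /\ mdist pq.1 pq.2 < delta].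
    rewrite /ob limf_einfE.
    apply: (@le_trans _ _ (ereal_inf ((fun pq : M * M => (ob_pair pq.1 pq.2)%:E) @` V))).
      apply: le_ereal_inf_tmp => _ [[p q] /= [pq pqd] <-].
      by rewrite lee_fin ltW// H.
    by apply: ereal_sup_ubound; exists V => //; exists delta.
  by exists delta => // M fam p q pq pqd; apply: lt_trans lt2 _; exact: H.
pose b := ball_volume R n / 2 ^+ n.
have b0 : 0 < b by rewrite divr_gt0 ?ball_volume_gt0// exprn_gt0.
(* The volume bound freed from its normalization, halved to be strict. *)
pose v0 := v / b / 2.
have v00 : 0 < v0 by apply: divr_gt0 => //; exact: divr_gt0.
pose A := packing_const D; pose K := expR D.
have A24 : 24 <= A := packing_const_ge D0.
have A0 : 0 < A by apply: lt_le_trans A24.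
(* A diameter too small for the volume: the minimum with 1 lets the [n]-th power be bounded by its
   base, at most [v0 / 2]. *)
pose d0 := Num.min D (Num.min 1 (v0 / 2) / (2 * A)).
have m0 : 0 < Num.min 1 (v0 / 2) by rewrite lt_min; lra.
have d00 : 0 < d0 by rewrite lt_min D0 divr_gt0// mulr_gt0.
have d0_small : (2 * A * d0) ^+ n < v0.
  have le1 : 2 * A * d0 <= Num.min 1 (v0 / 2).
    have : d0 <= Num.min 1 (v0 / 2) / (2 * A) by rewrite /d0 ge_min lexx orbT.
    have A2 : 0 < 2 * A by rewrite mulr_gt0.
    by rewrite ler_pdivlMr// [X in X <= _]mulrC.
  have pos : 0 <= 2 * A * d0 by rewrite mulr_ge0 ?(ltW d00)// mulr_ge0// ltW.
  move: le1; rewrite le_min => /andP[le1 le2].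
  apply: (@le_lt_trans _ _ (2 * A * d0)); last lra.
  by case: (n) n0 => // n' _; rewrite exprS ler_piMr// exprn_ile1.
(* Bounds the radius below: some two points are more than [d0] apart, and each point is at least
   [d0 / 2] away from one of them. *)
pose R0 := d0 / 2.
have R00 : 0 < R0 by rewrite divr_gt0.
have R0D : R0 <= D by have : d0 <= D; [rewrite /d0 ge_min lexx|rewrite /R0; lra].
pose Gamma := 32 * D ^+ 2 * K ^+ 6 / R0.
pose N := (Num.truncn ((4 * A ^+ 2 * Gamma) ^+ n / v0)).+1.
have N_big : (4 * A ^+ 2 * Gamma) ^+ n < N%:R * v0.
  by rewrite -ltr_pdivrMr//; exact: truncnS_gt.
pose mu := (16 * K ^+ 3 * N%:R)^-1.
have K0 : 0 < K by exact: expR_gt0.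
have mu0 : 0 < mu by rewrite invr_gt0 !mulr_gt0 ?exprn_gt0// ltr0n.
(* [c] and [delta] are such that the two terms of [delta_mu] contribute at most [mu * R0 / 4]
   each. *)
pose c := Num.min 1 (Num.min mu (mu * R0 / (4 * K))).
have c0 : 0 < c by rewrite !lt_min ltr01 mu0 divr_gt0// mulr_gt0.
have [c1 cmu cK] : [/\ c <= 1, c <= mu & c <= mu * R0 / (4 * K)].
  by rewrite /c !ge_min !lexx !orbT.
pose delta := Num.min (R0 / 8) (mu * R0 / (4 * K ^+ 2)).
have delta0 : 0 < delta by rewrite lt_min !divr_gt0// mulr_gt0// exprn_gt0.
have [dR dmu] : delta <= R0 / 8 /\ delta <= mu * R0 / (4 * K ^+ 2).
  by rewrite /delta !ge_min !lexx !orbT.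
have delta_mu : K * (K * delta + c) / (R0 / 2) <= mu.
  rewrite ler_pdivrMr ?divr_gt0//.
  have : K ^+ 2 * delta <= K ^+ 2 * (mu * R0 / (4 * K ^+ 2)) by rewrite ler_pM2l// exprn_gt0.
  have -> : K ^+ 2 * (mu * R0 / (4 * K ^+ 2)) = mu * R0 / 4 by field; rewrite gt_eqF.
  have : K * c <= K * (mu * R0 / (4 * K)) by rewrite ler_pM2l.
  have -> : K * (mu * R0 / (4 * K)) = mu * R0 / 4 by field; rewrite gt_eqF.
  by rewrite expr2; lra.
pose eps := (acos (- c) - pi / 2) / 2.
have eps0 : 0 < eps.
  by rewrite divr_gt0// subr_gt0 -acos0 acos_anti; clear -c0 c1; lra.
have c_eps : acos (- c) = pi / 2 + 2 * eps by rewrite /eps; field.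
exists eps, delta; split => // M [alexM dimM diamM vol].
have diamD (x y : M) : mdist x y <= D.
  by rewrite -lee_fin; apply: le_trans diamM; exact: mdist_diam.
have volM := alexandrov_family_measure v_gt0 vol.
have [x [y xy]] : exists x y : M, d0 < mdist x y.
  apply: contrapT => no; move: d0_small; apply/negP; rewrite -leNgt.
  apply: (diam_lower_bound n0 D0 alexM dimM diamD v00 volM d00) => x y.
  by rewrite leNgt; apply/negP => xy; apply: no; exists x, y.
have R0_rad : R0 <= Defs.rad M.
  apply: lb_le_inf => [|_ [p _ <-]]; first by exists (sup [set mdist x q | q in [set: M]]), x.
  have ub : has_ubound [set mdist p q | q in [set: M]] by exists D => _ [q _ <-].
  have px : mdist p x <= sup [set mdist p q | q in [set: M]] by apply: ub_le_sup => //; exists x.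
  have py : mdist p y <= sup [set mdist p q | q in [set: M]] by apply: ub_le_sup => //; exists y.
  by have := metric_triangle x p y; rewrite (metric_sym x p) /R0; lra.
have N0 : (0 < N)%N by [].
exact: (ob_pair_gt n0 N0 D0 alexM dimM diamD volM R00 R0D R0_rad N_big eps0 (ltW c0) c1 c_eps
  cmu dR delta_mu).
Qed.
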